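(* Let $d\geq 2$ and let $p_c$ be the critical probability of the site percolation model on $\mathbb{Z}^d$. Let $\alpha$ be a real number such that $$\alpha>\frac{2d^2+2d-2}{2d^2+3d-3}\,\bigl(4d^2+5d-5\bigr).$$ Then $$\lim_{n\to\infty}P_{p_c}\bigl(\text{two-arms}(\Lambda(n),n^\alpha)\bigr)=0.$$
   Context: Site percolation on $\mathbb{Z}^d$ with parameter $p$: each site is declared open with probability $p$ and closed with probability $1-p$, independently; $P_p$ is the corresponding probability. Two sites $x,y$ are neighbors if $|x-y|=1$ (Euclidean distance). $\theta(p)$ is the $P_p$-probability that the origin belongs to an infinite open cluster, and $p_c=\sup\{p:\theta(p)=0\}$. For a real $r\geq 0$, $\Lambda(r)=[-r,r]^d\cap\mathbb{Z}^d$. The internal boundary of $A\subset\mathbb{Z}^d$ is $\partial^{\mathrm{in}}A=\{x\in A:\exists y\in A^c,\ |x-y|=1\}$. The open clusters in a box are the connected components of the graph whose vertices are the open sites of the box and whose edges join nearest neighbors. For $n\ge 1$ an integer and $\ell\geq 1$, $\text{two-arms}(\Lambda(n),\ell)$ is the event that there exist two distinct open clusters in $\Lambda(n+\ell)$ (i.e. of the configuration restricted to $\Lambda(n+\ell)$) each joining $\Lambda(n)$ to $\partial^{\mathrm{in}}\Lambda(n+\ell)$, i.e. each intersecting both $\Lambda(n)$ and $\partial^{\mathrm{in}}\Lambda(n+\ell)$. *)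

(* Defs.v *)
From mathcomp Require Import all_boot all_order all_algebra finmap.
From mathcomp Require Import all_classical all_reals all_analysis.
From Stdlib Require Export Relation_Operators.

Set Implicit Arguments.
Unset Strict Implicit.
Unset Printing Implicit Defensive.

Import Order.TTheory GRing.Theory Num.Theory.

Local Open Scope classical_set_scope.
Local Open Scope ring_scope.

Definition site (d : nat) : Type := 'rV[int]_d.

Section Lattice.
Variables (R : realType) (d : nat).

Definition euclidean_dist (x y : site d) : R :=
  Num.sqrt (\sum_(i < d) ((x 0 i)%:~R - (y 0 i)%:~R) ^+ 2).

Definition neighbors (x y : site d) : Prop := euclidean_dist x y = 1.

Definition box (r : R) : set (site d) :=
  [set x | forall i : 'I_d, - r <= (x 0 i)%:~R <= r].

Definition inner_boundary (A : set (site d)) : set (site d) :=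
  [set x | A x /\ exists y, ~ A y /\ neighbors x y].

End Lattice.

Definition configuration (d : nat) : Type := site d -> bool.

Definition open_at (d : nat) (x : site d) : set (configuration d) :=
  [set w : configuration d | w x].

(* The product sigma-algebra on {0,1}^(Z^d). *)
Definition percolation_space (d : nat) :=
  g_sigma_algebraType (range (@open_at d)).

(* P is P_p.  The two conditions determine P uniquely (pi-lambda theorem); such
   a P exists for every p in [0, 1] (the product of Bernoulli measures). *)
Definition site_percolation (R : realType) (d : nat) (p : R)
    (P : probability (percolation_space d) R) : Prop :=
  (forall x : site d, P (open_at x) = p%:E) /\
  (forall s : {fset site d},
     P (\bigcap_(x in [set` s]) open_at x) =
       (\prod_(x <- s) P (open_at x))%E).

Section Clusters.
Variables (R : realType) (d : nat).

Definition open_sites (A : set (site d)) (w : configuration d) :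
  set (site d) := A `&` [set x | w x].

Definition adjacent_in (S : set (site d)) (x y : site d) : Prop :=
  [/\ S x, S y & neighbors R x y].

Definition open_cluster (A : set (site d)) (w : configuration d)
    (C : set (site d)) : Prop :=
  exists2 x, open_sites A w x &
    C = [set y | clos_refl_trans _ (adjacent_in (open_sites A w)) x y].

Definition origin_percolates : set (configuration d) :=
  [set w | exists C, [/\ open_cluster setT w C, C 0 & infinite_set C]].

Definition crossing_cluster (n : nat) (l : R) (w : configuration d)
    (C : set (site d)) : Prop :=
  [/\ open_cluster (box (n%:R + l)) w C,
      C `&` @box R d n%:R !=set0 &
      C `&` inner_boundary R (box (n%:R + l)) !=set0].

Definition two_arms (n : nat) (l : R) : set (configuration d) :=
  [set w | exists C1 C2, [/\ C1 <> C2,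
    crossing_cluster n l w C1 & crossing_cluster n l w C2]].

Definition theta (P : R -> probability (percolation_space d) R) (p : R) :
  \bar R := P p origin_percolates.

Definition critical_probability
    (P : R -> probability (percolation_space d) R) : R :=
  sup [set p | 0 <= p <= 1 /\ theta P p = 0%E].

End Clusters.

(* Main.v *)
Require Import Defs.
From mathcomp Require Import all_boot all_order all_algebra fingroup perm finmap.
From mathcomp Require Import all_classical all_reals all_analysis.
From mathcomp Require Import zify ring lra.
From Stdlib Require Operators_Properties.

(** Two clusters that cross the annulus between the cubes of half-sides [n] and
    [n + n ^ alpha] produce, at a cost polynomial in [n], a site with two arms of
    length of order [n ^ alpha]; the latter is unlikely because the two-arm
    exponent is at least one half.

    - Two-arm sites are rare ([two_arm_decay]).  In a box of side [N], the closed
      sites between two clusters touching the boundary are counted more often in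
      the boundaries of the individual clusters than in the boundary of their
      union.  Exploring a cluster reveals independent sites, so the numbers of its
      open sites and of its closed boundary sites are in ratio [p : 1 - p] up to
      a fluctuation of the order of the square root of its size; the excess is
      thus a sum of fluctuations, and is at most of order [N ^ (d - 1/2) log N]
      ([sum_prob_two_arms_at]).  The fluctuations are controlled by a change of
      the parameter [p] on the explored sites ([exploration_martingale]).

    - Connections at criticality are at least polynomially likely
      ([pr_conn_lower_bound]).  The expected number of boundary sites of a cube
      connected to its centre is bounded below at [pc], since otherwise it would
      be small slightly above [pc] too, and Simon's inequality ([simon]) would
      give exponential decay there ([critical_flux]).  Some boundary site thus
      has probability at least [c n ^ (1 - d)]; by reflection so has each
      coordinate direction, and [2 d] such connections, combined by positive
      association, join any two sites of the cube [n] inside the cube [2 n] with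
      probability at least [c n ^ (- 2 d (d - 1))].

    - Gluing ([gluing]).  Given two clusters crossing the annulus, the
      configuration away from them is fresh, hence with the above probability a
      path of the cube [2 n] would join them if it were not for its first and
      last sites.  Opening the first one turns the last one into a two-arm site.
      Summing over the positions of both sites, the crossing probability is at
      most [C n ^ (2 d (d - 1)) * n ^ (2 d)] times a two-arm probability
      ([crossing_le_two_arm]).

    Altogether the probability is at most
    [C n ^ (2 d ^ 2) * (n ^ alpha) ^ (- 1/2)] up to logarithms, and tends to zero
    because [alpha > 4 d ^ 2] ([exponent_gt]).  When [pc] is [0] or [1] no two
    clusters exist at all ([pr_crossing_degenerate]).

    Finite boxes are treated as finite graphs, with configurations encoded by
    their sets of open sites; [prob_finite_event] relates their product measures
    to the measure on the lattice. *)

Set Implicit Arguments.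
Unset Strict Implicit.
Unset Printing Implicit Defensive.

Import Order.TTheory GRing.Theory Num.Theory.
Import numFieldNormedType.Exports.

Local Open Scope ring_scope.

(** * Product measures on the subsets of a finite set *)

Section Expectation.
Import fintype boot.finset.
Variables (R : realType) (V : finType).
Implicit Types (w A D X : {set V}) (x z : V) (p : R) (f g : {set V} -> R).

Definition weight p w : R := \prod_z (if z \in w then p else 1 - p).

Definition expect p f : R := \sum_w weight p w * f w.

Definition prob p (Q : pred {set V}) : R := expect p (fun w => (Q w)%:R).

Lemma eq_expect p f g : f =1 g -> expect p f = expect p g.
Proof. by move=> fg; apply: eq_bigr => w _; rewrite fg. Qed.

Lemma expectD p f g :
  expect p (fun w => f w + g w) = expect p f + expect p g.
Proof. by rewrite -big_split; apply: eq_bigr => w _; rewrite mulrDr. Qed.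

Lemma expectZ p (c : R) f : expect p (fun w => c * f w) = c * expect p f.
Proof. by rewrite big_distrr; apply: eq_bigr => w _; rewrite mulrCA. Qed.

Lemma expect_sum p (I : Type) (r : seq I) (P : pred I)
    (f : I -> {set V} -> R) :
  expect p (fun w => \sum_(i <- r | P i) f i w) =
  \sum_(i <- r | P i) expect p (f i).
Proof.
rewrite /expect exchange_big; apply: eq_bigr => w _.
by rewrite big_distrr.
Qed.

(** Distributing the product of the sums over the two states of each site
    produces the sum over all configurations. *)
Lemma expect_prod p (F G : V -> R) :
  expect p (fun w => \prod_z (if z \in w then F z else G z)) =
  \prod_z (p * F z + (1 - p) * G z).
Proof.
rewrite bigA_distr; apply: eq_bigr => w _.
by rewrite -big_split; apply: eq_bigr => z _; case: (z \in w).
Qed.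

Lemma expect1 p : expect p (fun=> 1) = 1.
Proof.
transitivity (\prod_(z : V) (p * 1 + (1 - p) * 1)).
  rewrite -expect_prod; apply: eq_expect => w.
  by rewrite big1 // => z _; rewrite if_same.
by rewrite big1 // => z _; rewrite !mulr1 subrKC.
Qed.

Lemma expectC p c : expect p (fun=> c) = c.
Proof.
rewrite -[RHS]mulr1 -(expect1 p) -expectZ.
by apply: eq_expect => w; rewrite mulr1.
Qed.

Definition cylinder A D w := (A \subset w) && [disjoint D & w].

Lemma prob_cylinder p A D : [disjoint A & D] ->
  prob p (cylinder A D) = p ^+ #|A| * (1 - p) ^+ #|D|.
Proof.
move=> AD; pose F z : R := (z \notin D)%:R; pose G z : R := (z \notin A)%:R.
transitivity (expect p (fun w => \prod_z (if z \in w then F z else G z))).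
  apply: eq_expect => w; rewrite /cylinder.
  have [/andP[/subsetP Aw Dw]|] := boolP (_ && _).
    rewrite big1 // => z _; case: ifP => zw.
      by rewrite /F (disjointFl Dw).
    by rewrite /G; case: (boolP (z \in A)) => // /Aw; rewrite zw.
  rewrite negb_and => /orP[/subsetPn[z zA zw]|/pred0Pn[z /andP[/= zD zw]]].
    by rewrite (bigD1 z) //= (negPf zw) /G zA mul0r.
  by rewrite (bigD1 z) //= zw /F zD mul0r.
rewrite expect_prod.
have -> : p ^+ #|A| = \prod_z (if z \in A then p else 1).
  by rewrite -big_mkcond prodr_const.
have -> : (1 - p) ^+ #|D| = \prod_z (if z \in D then 1 - p else 1).
  by rewrite -big_mkcond prodr_const.
rewrite -big_split; apply: eq_bigr => z _; rewrite /F /G /=.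
have [zA|zA] := boolP (z \in A).
  by rewrite (disjointFr AD zA) /=; ring.
by case: (z \in D) => /=; ring.
Qed.

Section Positive.
Variables (p : R).
Hypothesis p01 : 0 <= p <= 1.

Lemma weight_ge0 w : 0 <= weight p w.
Proof.
by apply: prodr_ge0 => z _; case: ifP => _; case/andP: p01 => // *;
  rewrite subr_ge0.
Qed.

Lemma ler_expect f g : (forall w, f w <= g w) -> expect p f <= expect p g.
Proof. by move=> fg; apply: ler_sum => w _; rewrite ler_wpM2l ?weight_ge0. Qed.

Lemma expect_ge0 f : (forall w, 0 <= f w) -> 0 <= expect p f.
Proof. by move=> f0; apply: sumr_ge0 => w _; rewrite mulr_ge0 ?weight_ge0. Qed.

Lemma prob_ge0 Q : 0 <= prob p Q.
Proof. exact: expect_ge0. Qed.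

Lemma prob_sub (Q Q' : pred {set V}) :
  (forall w, Q w -> Q' w) -> prob p Q <= prob p Q'.
Proof.
by move=> QQ; apply: ler_expect => w; case: (boolP (Q w)) => // /QQ ->.
Qed.

End Positive.

(** ** Resampling one site *)

Definition resample p x f : {set V} -> R :=
  fun w => p * f (x |: w) + (1 - p) * f (w :\ x).

Lemma weight_D1 p x w :
  weight p w = (if x \in w then p else 1 - p) *
               \prod_(z | z != x) (if z \in w then p else 1 - p).
Proof. by rewrite /weight (bigD1 x). Qed.

Lemma expect_resample p x f : expect p (resample p x f) = expect p f.
Proof.
pose r w : R := \prod_(z | z != x) (if z \in w then p else 1 - p).
have rU w : r (x |: w) = r w.
  by apply: eq_bigr => z zx; rewrite in_setU1 (negPf zx).
have rD w : r (w :\ x) = r w.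
  by apply: eq_bigr => z zx; rewrite in_setD1 zx.
have split_x g : expect p g =
    \sum_(w : {set V} | x \notin w) r w * (p * g (x |: w) + (1 - p) * g w).
  rewrite /expect (bigID (fun w : {set V} => x \in w)) /=.
  under [in RHS]eq_bigr do rewrite mulrDr.
  rewrite [RHS]big_split /=; congr (_ + _); last first.
    by apply: eq_bigr => w xw; rewrite (weight_D1 p x) (negPf xw) -/(r w); ring.
  rewrite (reindex_onto (fun w => x |: w) (fun w => w :\ x)) /=; last first.
    by move=> w xw; rewrite setD1K.
  apply: eq_big => [w|w _].
    rewrite setU11 /=; apply/eqP/idP => [<-|xw]; first by rewrite setD11.
    by rewrite setU1K.
  by rewrite (weight_D1 p x) setU11 -/(r _) rU; ring.
rewrite !split_x; apply: eq_bigr => w xw; rewrite /resample.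
rewrite setUA setUid setU1K //.
have -> : w :\ x = w by apply/setDidPl; rewrite disjoint_sym disjoints1.
by ring.
Qed.

Definition resample_all p (s : seq V) f := foldr (resample p) f s.

Lemma expect_resample_all p s f : expect p (resample_all p s f) = expect p f.
Proof. by elim: s => //= x s IH; rewrite expect_resample. Qed.

Definition depends_on X f := forall w w', w :&: X = w' :&: X -> f w = f w'.

Lemma depends_on_mem X f w w' : depends_on X f ->
  (forall z, z \in X -> (z \in w) = (z \in w')) -> f w = f w'.
Proof.
move=> fX ww; apply: fX; apply/setP => z; rewrite !inE.
by case: (boolP (z \in X)) => [/ww ->|_]; rewrite ?andbF.
Qed.

Lemma resample_depends p x X f :
  depends_on X f -> depends_on (X :\ x) (resample p x f).
Proof.
move=> fX w w' ww; rewrite /resample.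
have in_eq z : z \in X -> z != x -> (z \in w) = (z \in w').
  move=> zX zx; have /setP/(_ z) := ww.
  by rewrite !inE zX zx !andbT.
congr (_ * _ + _ * _); apply: (depends_on_mem fX) => z zX; rewrite !inE.
  by case: eqVneq => //= zx; apply: in_eq.
by case: eqVneq => //= zx; apply: in_eq.
Qed.

Lemma resample_all_depends p s X f :
  depends_on X f -> depends_on (X :\: [set:: s]) (resample_all p s f).
Proof.
move=> fX; elim: s => [|x s IH] /=.
  by rewrite set_nil setD0.
by rewrite set_cons setUC -setDDl; apply: resample_depends.
Qed.

Lemma resample_all_const p f w :
  resample_all p (enum V) f w = expect p f.
Proof.
rewrite -(expect_resample_all p (enum V)) -[LHS](expectC p).
apply: eq_expect => w'.
have fT : depends_on [set: V] f by move=> u v; rewrite !setIT => ->.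
have h := resample_all_depends p (s := enum V) fT.
by apply: h; apply/setP => z; rewrite !inE mem_enum ?andbF.
Qed.

(** Independence of disjoint sets of sites: resampling all the sites of [X]
    averages [f] out and leaves [g] untouched. *)
Lemma expect_indep p X f g :
  depends_on X f -> depends_on (~: X) g ->
  expect p (fun w => f w * g w) = expect p f * expect p g.
Proof.
move=> fX gX.
have gx x w : x \in X -> (g (x |: w) = g w) * (g (w :\ x) = g w).
  move=> xX; split; apply: (depends_on_mem gX) => z;
    rewrite !inE; case: eqVneq => [->|//]; by rewrite xX.
have mul_out s w : {subset s <= X} ->
    resample_all p s (fun w => f w * g w) w = resample_all p s f w * g w.
  elim: s w => [//|x s IH] w sX /=; rewrite /resample.
  have xX : x \in X by apply: sX; rewrite mem_head.
  have sX' : {subset s <= X} by move=> z zs; apply: sX; rewrite in_cons zs orbT.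
  by rewrite !IH // !gx //; ring.
have fc w : resample_all p (enum X) f w = expect p f.
  rewrite -(expect_resample_all p (enum X)) -[LHS](expectC p).
  have h := resample_all_depends p (s := enum X) fX.
  apply: eq_expect => w'; apply: h.
  by apply/setP => z; rewrite !inE mem_enum; case: (z \in X); rewrite ?andbF.
rewrite -(expect_resample_all p (enum X)) -expectZ; apply: eq_expect => w.
by rewrite mul_out ?fc // => z; rewrite mem_enum.
Qed.

(** ** Positive association *)

Definition increasing f := forall w w', w \subset w' -> f w <= f w'.

(** Conditionally on the other sites, two increasing functions of one site are
    positively correlated; resampling the sites one by one propagates this. *)
Lemma harris p f g : 0 <= p <= 1 -> increasing f -> increasing g ->
  expect p f * expect p g <= expect p (fun w => f w * g w).
Proof.
move=> p01 fi gi.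
have r_inc x h : increasing h -> increasing (resample p x h).
  move=> hi w w' ww; rewrite /resample lerD // ler_wpM2l ?hi //; try lra.
    exact: setUS.
  exact: setSD.
have rs_inc s h : increasing h -> increasing (resample_all p s h).
  by move=> hi; elim: s => //= x s; apply: r_inc.
have r_mono x (h h' : {set V} -> R) : (forall w, h w <= h' w) ->
    forall w, resample p x h w <= resample p x h' w.
  by move=> hh w; rewrite /resample lerD // ler_wpM2l ?hh //; lra.
have key s w : resample_all p s f w * resample_all p s g w <=
    resample_all p s (fun w => f w * g w) w.
  elim: s w => [|x s IH] w //=.
  apply: le_trans (r_mono x _ _ IH w).
  have Fi := rs_inc s f fi; have Gi := rs_inc s g gi.
  rewrite /resample; set F := resample_all p s f; set G := resample_all p s g.
  have sub : w :\ x \subset x |: w.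
    by apply: subset_trans (subsetDl _ _) (subsetUr _ _).
  have := Fi _ _ sub; have := Gi _ _ sub; rewrite -/F -/G.
  move: (F _) (F _) (G _) (G _) => F1 F0 G1 G0 h1 h2; rewrite -subr_ge0.
  have -> : p * (F1 * G1) + (1 - p) * (F0 * G0) -
    (p * F1 + (1 - p) * F0) * (p * G1 + (1 - p) * G0) =
    p * (1 - p) * ((F1 - F0) * (G1 - G0)) by ring.
  by apply: mulr_ge0; apply: mulr_ge0; rewrite ?subr_ge0 //; case/andP: p01.
by have := key (enum V) set0; rewrite !resample_all_const.
Qed.

Lemma expect_open p x f : 0 <= p <= 1 -> (forall w, 0 <= f w) ->
  p * expect p (fun w => f (x |: w)) <= expect p f.
Proof.
move=> p01 f0; rewrite -(expect_resample p x f) -expectZ.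
apply: ler_expect => // w; rewrite /resample lerDl mulr_ge0 //; lra.
Qed.

(** The event [Q (w :\ x)] ignores the state of [x], hence is independent of it. *)
Lemma prob_closed p x (Q : pred {set V}) :
  prob p (fun w => (x \notin w) && Q (w :\ x)) =
  (1 - p) * prob p (fun w => Q (w :\ x)).
Proof.
rewrite /prob -(expect_resample p x) -expectZ; apply: eq_expect => w.
rewrite /resample setU11 setD11 /= mulr0 add0r.
by rewrite setDDl setUid.
Qed.

End Expectation.

(** * Clusters of a finite graph *)

Section FiniteGraph.
Import fintype boot.finset.
Variables (V : finType) (e : rel V).
Hypothesis e_sym : symmetric e.
Implicit Types (w A B D S T U X Y Z : {set V}) (x y z : V).

Definition within X : rel V := [rel x y | [&& x \in X, y \in X & e x y]].

Definition cluster X x := [set y | (x \in X) && connect (within X) x y].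

Definition reach X S := \bigcup_(x in S) cluster X x.

Definition outer A := [set z | (z \notin A) && [exists y in A, e y z]].

(** The sites found closed when the open clusters of [S] are explored and
    turn out to have union [A]. *)
Definition frontier S A :=
  [set z | (z \notin A) && ((z \in S) || [exists y in A, e y z])].

Lemma within_sym X : connect_sym (within X).
Proof.
apply: (@sym_connect_sym _ (within X)) => x y.
by rewrite /within /= e_sym andbCA.
Qed.

Lemma cluster_ind X x Z : (x \in X -> x \in Z) ->
  (forall y z, y \in X -> y \in Z -> z \in X -> e y z -> z \in Z) ->
  cluster X x \subset Z.
Proof.
move=> xZ Zc; apply/subsetP => y; rewrite inE => /andP[/xZ {}xZ].
case/connectP => p; elim: p x xZ => [|a p IH] x xZ /=; first by move=> _ ->.
by case/andP => /and3P[xX aX exa]; apply: IH; apply: Zc exa.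
Qed.

Lemma cluster_subl X x : cluster X x \subset X.
Proof. by apply: cluster_ind. Qed.

Lemma cluster_src X x y : y \in cluster X x -> x \in X.
Proof. by rewrite inE => /andP[]. Qed.

Lemma cluster_refl X x : (x \in cluster X x) = (x \in X).
Proof. by rewrite inE connect0 andbT. Qed.

Lemma cluster_step X x y z :
  y \in cluster X x -> z \in X -> e y z -> z \in cluster X x.
Proof.
move=> yx zX eyz; have yX := subsetP (cluster_subl X x) _ yx.
move: yx; rewrite !inE => /andP[-> cxy] /=; apply: connect_trans cxy _.
by apply: connect1; rewrite /within /= yX zX.
Qed.

Lemma cluster_eq X x y : y \in cluster X x -> cluster X y = cluster X x.
Proof.
move=> yx; have yX := subsetP (cluster_subl X x) _ yx.
move: yx; rewrite inE => /andP[xX cxy]; apply/setP => z; rewrite !inE yX xX /=.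
exact/esym/(same_connect (within_sym X)).
Qed.

Lemma cluster_subX X Y x : X \subset Y -> cluster X x \subset cluster Y x.
Proof.
move=> /subsetP XY; apply: cluster_ind => [/XY|y z _ yY /XY zY].
  by rewrite cluster_refl.
exact: cluster_step.
Qed.

Lemma cluster_idem X x : cluster (cluster X x) x = cluster X x.
Proof.
apply/eqP; rewrite eqEsubset cluster_subl.
suff : cluster X x \subset cluster X x :&: cluster (cluster X x) x.
  by move/subset_trans; apply; apply: subsetIr.
apply: cluster_ind => [xX|y z yX]; first by rewrite inE !cluster_refl xX.
rewrite !in_setI => /andP[yx yxx] zX eyz.
have zx := cluster_step yx zX eyz.
by rewrite zx (cluster_step yxx zx eyz).
Qed.

Lemma reachP X S y :
  reflect (exists2 x, x \in S & y \in cluster X x) (y \in reach X S).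
Proof. exact: bigcupP. Qed.

Lemma reach_set1 X x : reach X [set x] = cluster X x.
Proof. by rewrite /reach big_set1. Qed.

Lemma reach_subl X S : reach X S \subset X.
Proof. by apply/bigcupsP => x _; apply: cluster_subl. Qed.

Lemma frontier_reach X S : [disjoint frontier S (reach X S) & X].
Proof.
rewrite disjoint_sym; apply/pred0P => z /=; apply/negbTE.
rewrite negb_and -implybE; apply/implyP => zX; rewrite inE negb_and negbK.
case: (boolP (z \in reach X S)) => //= zr.
rewrite negb_or; apply/andP; split.
  by apply: contra zr => zS; apply/reachP; exists z => //; rewrite cluster_refl.
apply: contra zr => /existsP[y /andP[/reachP[x xS yx] eyz]].
by apply/reachP; exists x => //; apply: cluster_step eyz.
Qed.

(** Whether the exploration from [S] returns [A] is decided by the sites of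
    [A] and of its frontier. *)
Lemma reach_cylinder w w' S :
  (reach w' S == reach w S) = cylinder (reach w S) (frontier S (reach w S)) w'.
Proof.
apply/eqP/andP => [<-|[/subsetP Aw' Dw']].
  by rewrite reach_subl frontier_reach.
apply/eqP; rewrite eqEsubset; apply/andP; split.
  apply/bigcupsP => x xS; apply: cluster_ind => [xw'|y z yw' yA zw' eyz].
    apply: contraTT xw' => xA.
    by apply/negbT/(disjointFr Dw'); rewrite inE xA xS.
  apply: contraTT zw' => zA; apply/negbT/(disjointFr Dw').
  by rewrite inE zA; apply/orP; right; apply/existsP; exists y; rewrite yA.
apply/subsetP => y yA; move: (yA) => /reachP[x xS yx].
apply/reachP; exists x => //; rewrite -cluster_idem in yx.
apply: subsetP yx; apply: cluster_subX; apply/subsetP => z zx.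
by apply: Aw'; apply/reachP; exists x.
Qed.

Lemma disjoint_frontier S A : [disjoint A & frontier S A].
Proof.
rewrite disjoints_subset; apply/subsetP => z zA.
by rewrite !inE zA.
Qed.

Section Exploration.
Variable R : realType.
Implicit Types (p : R).

Lemma expect_reach p S (F : {set V} -> R) :
  expect p (fun w => F (reach w S)) =
  \sum_(A | [exists w, reach w S == A])
    F A * (p ^+ #|A| * (1 - p) ^+ #|frontier S A|).
Proof.
transitivity (expect p (fun w =>
  \sum_(A | [exists w, reach w S == A]) F A * (reach w S == A)%:R)).
  apply: eq_expect => w; rewrite (bigD1 (reach w S)) /=; last first.
    by apply/existsP; exists w.
  rewrite eqxx mulr1 big1 ?addr0 // => A /andP[_ /negPf AS].
  by rewrite eq_sym AS mulr0.
rewrite expect_sum; apply: eq_bigr => A /existsP[w /eqP <-].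
rewrite expectZ -prob_cylinder ?disjoint_frontier //; congr (_ * _).
by apply: eq_expect => w'; rewrite reach_cylinder.
Qed.

(** The likelihood ratio of parameter [p + l * p * (1 - p)] against parameter
    [p], restricted to the explored sites, has mean one.  This plays the role
    of the exponential martingale of the exploration. *)
Lemma exploration_martingale p (l : R) S :
  expect p (fun w => (1 + l * (1 - p)) ^+ #|reach w S| *
    (1 - l * p) ^+ #|frontier S (reach w S)|) = 1.
Proof.
pose F A := (1 + l * (1 - p)) ^+ #|A| * (1 - l * p) ^+ #|frontier S A|.
pose p' := p + l * p * (1 - p).
transitivity (expect p' (fun w => (fun=> 1) (reach w S))); last exact: expect1.
rewrite -[LHS]/(expect p (fun w => F (reach w S))) (expect_reach p S F).
rewrite (expect_reach p' S (fun=> 1)).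
apply: eq_bigr => A _; have -> : p' = (1 + l * (1 - p)) * p by rewrite /p'; ring.
have -> : 1 - (1 + l * (1 - p)) * p = (1 - l * p) * (1 - p) by ring.
by rewrite mul1r !exprMn mulrACA.
Qed.

End Exploration.


(** ** Closed sites touching two arms *)

Definition meets A S := [exists s in S, s \in A].

(** Removing [b] makes the event independent of the state of [b], so that its
    probability is read off from the number of closed sites realizing it. *)
Definition two_arms_at S w b := [exists x, exists y,
  [&& e b x, e b y, cluster (w :\ b) x != cluster (w :\ b) y,
      meets (cluster (w :\ b) x) S & meets (cluster (w :\ b) y) S]].

Lemma two_arms_at_D1 S w b : two_arms_at S (w :\ b) b = two_arms_at S w b.
Proof. by rewrite /two_arms_at setDDl setUid. Qed.

Lemma meets_cluster w x S : meets (cluster w x) S ->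
  exists s, [/\ s \in S, s \in w & cluster w x = cluster w s].
Proof.
case/existsP => s /andP[sS sx]; exists s; split=> //.
  exact: (subsetP (cluster_subl w x)).
by rewrite (cluster_eq sx).
Qed.

Lemma outer_nbr w x z : z \in outer (cluster w x) ->
  exists2 y, e z y & cluster w x = cluster w y.
Proof.
rewrite inE => /andP[_ /existsP[y /andP[yx eyz]]].
by exists y; rewrite ?(cluster_eq yx) // e_sym.
Qed.

Section TouchingClusters.
Variables (S w : {set V}) (Delta : nat).
Hypothesis degree : forall x, (#|[set y | e x y]| <= Delta)%N.

Let touching := [set cluster w s | s in S :&: w].

Let bigouter := \bigcup_(C in touching) outer C.

(** A cluster adjacent to [z] is determined by any neighbour of [z] in it. *)
Lemma card_imset_degree (Q : pred {set V}) z :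
  (forall C, Q C -> exists2 y, e z y & C = cluster w y) ->
  (#|[set C | Q C]| <= Delta)%N.
Proof.
move=> Qz; apply: leq_trans (degree z).
apply: leq_trans (leq_imset_card (cluster w) _); apply/subset_leq_card.
apply/subsetP => C; rewrite inE => /Qz[y ezy ->].
by apply: imset_f; rewrite inE.
Qed.

Lemma touchingP C : C \in touching -> exists2 s, s \in S :&: w & C = cluster w s.
Proof. by case/imsetP => s sS ->; exists s. Qed.

Lemma sum_card_touching : (\sum_(C in touching) #|C|)%N = #|reach w S|.
Proof.
have tr : trivIset touching.
  apply/trivIsetP => A B /touchingP[s sS ->] /touchingP[t tS ->] st.
  apply: contraNT st => /pred0Pn[z /andP[/= zs zt]].
  by rewrite -(cluster_eq zs) -(cluster_eq zt).
move/eqP: tr => ->; congr #|pred_of_set _|; apply/setP => z.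
apply/bigcupP/reachP => [[C /touchingP[s]]|[s sS zs]].
  by rewrite inE => /andP[sS sw] -> zs; exists s.
exists (cluster w s) => //; apply: imset_f.
by rewrite inE sS (cluster_src zs).
Qed.

Lemma sum_card_outerE (P : {set {set V}}) :
  (\sum_(C in P) #|outer C|)%N = (\sum_z #|[set C in P | z \in outer C]|)%N.
Proof.
under eq_bigr do rewrite -sum1_card.
rewrite (exchange_big_dep predT) //=; apply: eq_bigr => z _.
by rewrite sum1_card cardsE.
Qed.

Lemma sum_card_outer : (\sum_(C in touching) #|outer C| <= Delta * #|V|)%N.
Proof.
rewrite sum_card_outerE mulnC -sum_nat_const; apply: leq_sum => z _.
apply: (card_imset_degree (z := z)) => C /andP[/touchingP[s _ ->] /outer_nbr].
by [].
Qed.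

(** A closed site between two touching clusters is counted at least
    twice on the right, and once in the union of the outer boundaries. *)
Lemma double_counting :
  (#|[set b | (b \notin w) && two_arms_at S w b]| + #|bigouter| <=
    \sum_(C in touching) #|outer C|)%N.
Proof.
have cardE (A : {set V}) : #|A| = (\sum_z (z \in A))%N.
  by rewrite -sum1_card big_mkcond; apply: eq_bigr => z _; case: ifP.
rewrite sum_card_outerE (cardE [set b | _]) (cardE bigouter) -big_split /=.
apply: leq_sum => z _.
rewrite inE; case: (boolP (_ && _)) => [|_]; last first.
  rewrite add0n; case: (boolP (z \in bigouter)) => // /bigcupP[C CC zC].
  by apply/card_gt0P; exists C; rewrite inE CC.
case/andP => zw.
have wz : w :\ z = w by apply/setDidPl; rewrite disjoint_sym disjoints1.
rewrite /two_arms_at wz => /existsP[x /existsP[y /and5P[zx zy xy]]].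
move=> /meets_cluster[s [sS sw xs]] /meets_cluster[t [tS tw yt]].
have mem_outer u v : e z u -> v \in S -> v \in w -> cluster w u = cluster w v ->
    cluster w u \in [set C in touching | z \in outer C].
  move=> zu vS vw uv; rewrite inE; apply/andP; split.
    by rewrite uv; apply: imset_f; rewrite inE vS.
  rewrite inE; apply/andP; split.
    by apply: contra zw; apply: (subsetP (cluster_subl w u)).
  apply/existsP; exists u; rewrite e_sym zu andbT cluster_refl.
  by apply: (@cluster_src w u v); rewrite uv cluster_refl.
apply: (@leq_trans #|[set cluster w x; cluster w y]|).
  by rewrite cards2 xy; case: (z \in bigouter).
apply/subset_leq_card/subsetP => C; rewrite in_set2 => /orP[] /eqP ->.
  exact: mem_outer zx sS sw xs.
exact: mem_outer zy tS tw yt.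
Qed.

Lemma frontier_touching :
  (#|frontier S (reach w S)| <= #|S| + #|bigouter|)%N.
Proof.
apply: leq_trans (leq_card_setU _ _); apply/subset_leq_card/subsetP => z.
rewrite [in X in X -> _]inE inE => /andP[zr /orP[->//|/existsP[y]]].
case/andP => /reachP[s sS ys] eyz; apply/orP; right.
apply/bigcupP; exists (cluster w s).
  by apply: imset_f; rewrite inE sS (cluster_src ys).
rewrite inE; apply/andP; split; last by apply/existsP; exists y; rewrite ys.
by apply: contra zr => zs; apply/reachP; exists s.
Qed.

Lemma sum_touching_le (R : realType) (g : {set V} -> R) :
  (forall C, 0 <= g C) ->
  \sum_(C in touching) g C <= \sum_(s in S) g (cluster w s).
Proof.
move=> g0; rewrite [leRHS](bigID (fun s => s \in w)) /=.
apply: (@le_trans _ _ (\sum_(s in S :&: w) g (cluster w s))); last first.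
  have -> : \sum_(s in S :&: w) g (cluster w s) =
      \sum_(s in S | s \in w) g (cluster w s).
    by apply: eq_bigl => s; rewrite in_setI.
  by rewrite lerDl sumr_ge0.
rewrite (partition_big_imset (cluster w)); apply: ler_sum => C /touchingP[s sS ->].
by rewrite (bigD1 s) ?sS ?eqxx //= lerDl sumr_ge0.
Qed.

End TouchingClusters.

Lemma frontier_set1 w x : x \in w ->
  frontier [set x] (cluster w x) = outer (cluster w x).
Proof.
move=> xw; apply/setP => z; rewrite !inE.
by case: eqVneq => [->|_] //; rewrite xw connect0.
Qed.

Section ArmBound.
Variable R : realType.
Implicit Types (p l L : R).

Lemma expR_le1D (x : R) : - 2^-1 <= x -> expR (x - 2 * x ^+ 2) <= 1 + x.
Proof.
move=> x2; rewrite -[leLHS]invrK -expRN; have x1 : 0 < 1 + x by lra.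
rewrite -[leRHS]invrK lef_pV2 ?posrE ?invr_gt0 ?expR_gt0 //.
apply: le_trans (expR_ge1Dx _).
rewrite -div1r ler_pdivrMr // -subr_ge0.
have -> : (1 + - (x - 2 * x ^+ 2)) * (1 + x) - 1 = x ^+ 2 * (1 + 2 * x) by ring.
by apply: mulr_ge0; [exact: sqr_ge0|lra].
Qed.

Definition ratio p l (a b : nat) : R := (1 + l * (1 - p)) ^+ a * (1 - l * p) ^+ b.

Lemma mul_unit_bounds (l q : R) : 0 <= q <= 1 -> - 2^-1 <= l <= 2^-1 ->
  - 2^-1 <= l * q <= 2^-1 /\ (l * q) ^+ 2 <= l ^+ 2.
Proof.
move=> q01 l2; split; first by nra.
by rewrite exprMn ler_piMr ?sqr_ge0 // exprn_ile1; lra.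
Qed.

Lemma ratio_ge0 p l a b : 0 <= p <= 1 -> - 2^-1 <= l <= 2^-1 ->
  0 <= ratio p l a b.
Proof. move=> p01 l2; have [b1 _] := mul_unit_bounds p01 l2.
have [|b2 _] := @mul_unit_bounds l (1 - p) _ l2; first by lra.
by rewrite mulr_ge0 ?exprn_ge0 //; lra.
Qed.

(** The bound [exp (l h - 2 l^2 (a + b)) <= ratio], where [h] is the centred
    number of open sites among [a + b] explored ones, in the form
    [t <= L + exp (t - L)].  With [L] the logarithm of the number of
    explorations, the last terms of all of them add up to a constant. *)
Lemma deviation p l L (a b : nat) : 0 <= p <= 1 -> - 2^-1 <= l <= 2^-1 ->
  l * ((1 - p) * a%:R - p * b%:R) <=
  2 * l ^+ 2 * (a + b)%:R + L + expR (- L) * ratio p l a b.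
Proof.
move=> p01 l2; have [b1 c1] := mul_unit_bounds p01 l2.
have [|b2 c2] := @mul_unit_bounds l (1 - p) _ l2; first by lra.
pose t := l * ((1 - p) * a%:R - p * b%:R) - 2 * l ^+ 2 * (a + b)%:R.
have tL : t <= L + expR (t - L) by have := expR_ge1Dx (t - L); lra.
suff h : expR (t - L) <= expR (- L) * ratio p l a b.
  have : t <= L + expR (- L) * ratio p l a b by lra.
  by rewrite /t; lra.
rewrite addrC expRD ler_wpM2l ?expR_ge0 //.
have -> : t = a%:R * (l * (1 - p) - 2 * l ^+ 2) + b%:R * (- (l * p) - 2 * l ^+ 2).
  by rewrite /t natrD; ring.
rewrite expRD !expRM_natl /ratio; apply: ler_pM; rewrite ?exprn_ge0 ?expR_ge0 //.
  rewrite lerXn2r ?nnegrE ?expR_ge0 //; first by lra.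
  apply: le_trans (expR_le1D _); last by lra.
  by rewrite ler_expR; lra.
rewrite lerXn2r ?nnegrE ?expR_ge0 //; first by lra.
apply: le_trans (expR_le1D _); last by lra.
by rewrite ler_expR sqrrN; lra.
Qed.

(** With [h A = (1 - p) |A| - p |frontier A|], [double_counting] bounds [p N] by
    [h] of the union of the touching clusters minus the sum of their [h], up to
    [p |S|].  Each term is a fluctuation, bounded by [deviation] with slope [l]
    for the union and [- l] for the individual clusters. *)
Lemma touching_bound p l L S w (Delta : nat) :
  (forall x, #|[set y | e x y]| <= Delta)%N ->
  0 <= p <= 1 -> 0 <= l <= 2^-1 -> 0 <= L ->
  l * p * #|[set b | (b \notin w) && two_arms_at S w b]|%:R <=
  l * #|S|%:R + 2 * l ^+ 2 * ((2 + Delta) * #|V|)%:R + #|S|%:R * L +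
  ratio p l #|reach w S| #|frontier S (reach w S)| +
  expR (- L) * \sum_(s in S) ratio p (- l) #|reach w [set s]|
                                #|frontier [set s] (reach w [set s])|.
Proof.
move=> deg p01 l2 L0; have l2' : - 2^-1 <= l <= 2^-1 by lra.
have l2N : - 2^-1 <= - l <= 2^-1 by lra.
set N := #|_|; pose K := [set cluster w s | s in S :&: w].
have dc := double_counting S w; have fr := frontier_touching S w.
have ou := sum_card_outer S w deg; have cl := sum_card_touching S w.
rewrite -/K -/N in dc fr ou cl.
move: (\bigcup_(C in K) outer C) dc fr => O dc fr.
pose r := #|reach w S|; pose f := #|frontier S (reach w S)|.
rewrite -/r -/f in cl fr *.
have rV : (r + f <= #|V|)%N.
  by rewrite /r /f -cardsUI (disjoint_setI0 (disjoint_frontier _ _)) cards0 addn0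
    max_card.
have lp0 : 0 <= l * p by rewrite mulr_ge0; lra.
have l20 : 0 <= 2 * l ^+ 2 by rewrite pmulr_rge0 ?sqr_ge0.
have devS : l * ((1 - p) * r%:R - p * f%:R) <=
    2 * l ^+ 2 * #|V|%:R + ratio p l r f.
  apply: le_trans (deviation 0 r f p01 l2') _.
  by rewrite oppr0 expR0 mul1r addr0 lerD2r ler_wpM2l ?ler_nat.
pose g s := ratio p (- l) #|reach w [set s]| #|frontier [set s] (reach w [set s])|.
have devK C : C \in K -> - l * ((1 - p) * #|C|%:R - p * #|outer C|%:R) <=
    2 * l ^+ 2 * (#|C| + #|outer C|)%:R + (L +
      expR (- L) * ratio p (- l) #|C| #|outer C|).
  by move=> _; rewrite addrA -(sqrrN l); apply: deviation.
have sumK : \sum_(C in K) - l * ((1 - p) * #|C|%:R - p * #|outer C|%:R) <=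
    2 * l ^+ 2 * ((1 + Delta) * #|V|)%:R + (#|S|%:R * L +
     expR (- L) * \sum_(s in S) g s).
  apply: le_trans (ler_sum _ devK) _; rewrite big_split /=; apply: lerD.
    rewrite -mulr_sumr -natr_sum ler_wpM2l // ler_nat big_split /=.
    by rewrite cl mulnDl mul1n leq_add // (leq_trans _ rV) // leq_addr.
  have gE : #|S|%:R * L + expR (- L) * \sum_(s in S) g s =
      \sum_(s in S) (L + expR (- L) * g s).
    by rewrite big_split /= -mulr_sumr sumr_const mulr_natl.
  rewrite gE; pose h A := L + expR (- L) * ratio p (- l) #|A| #|outer A|.
  have h0 A : 0 <= h A.
    by rewrite addr_ge0 // mulr_ge0 ?expR_ge0 //; apply: ratio_ge0.
  apply: le_trans (sum_touching_le S w h0) _; apply: ler_sum => s _.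
  rewrite lerD2l ler_wpM2l ?expR_ge0 // /g reach_set1.
  have [sw|sw] := boolP (s \in w); first by rewrite frontier_set1.
  have -> : cluster w s = set0.
    by apply/setP => z; rewrite !inE (negPf sw).
  have -> : outer set0 = set0.
    by apply/setP => z; rewrite !inE; apply/existsP => -[y]; rewrite inE.
  have -> : frontier [set s] set0 = [set s].
    apply/setP => z; rewrite !inE; case: eqVneq => //= _.
    by apply/existsP => -[y]; rewrite inE.
  rewrite cards0 cards1 /ratio !expr0 expr1 mul1r.
  lra.
have dcR : l * p * (N + #|O|)%:R <= l * p * (\sum_(C in K) #|outer C|)%:R.
  by rewrite ler_wpM2l // ler_nat.
have frR : l * p * f%:R <= l * p * (#|S| + #|O|)%:R by rewrite ler_wpM2l // ler_nat.
have pS : l * p * #|S|%:R <= l * #|S|%:R.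
  by rewrite ler_wpM2r // ler_piMr; lra.
have sumKE : \sum_(C in K) - l * ((1 - p) * #|C|%:R - p * #|outer C|%:R) =
    - l * ((1 - p) * r%:R - p * (\sum_(C in K) #|outer C|)%:R).
  rewrite -mulr_sumr; congr (_ * _); rewrite sumrB -!mulr_sumr -!natr_sum.
  by rewrite cl.
rewrite sumKE in sumK.
move: dcR frR devS sumK; rewrite !(natrD, natrM).
set X := \sum_(s in S) _; set Y := (\sum_(C in K) _)%:R; lra.
Qed.

(** The Aizenman-Kesten-Newman bound.  Taking expectations in [touching_bound],
    every [ratio] has mean one by [exploration_martingale]. *)
Lemma sum_prob_two_arms_at p l L S (Delta : nat) :
  (forall x, #|[set y | e x y]| <= Delta)%N ->
  0 <= p <= 1 -> 0 <= l <= 2^-1 -> 0 <= L ->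
  l * p * (1 - p) * \sum_b prob p (fun w => two_arms_at S w b) <=
  l * #|S|%:R + 2 * l ^+ 2 * ((2 + Delta) * #|V|)%:R + #|S|%:R * L + 1 +
  expR (- L) * #|S|%:R.
Proof.
move=> deg p01 l2 L0.
have -> : l * p * (1 - p) * \sum_b prob p (fun w => two_arms_at S w b) =
    expect p (fun w => l * p * #|[set b | (b \notin w) && two_arms_at S w b]|%:R).
  rewrite expectZ -[LHS]mulrA; congr (_ * _); rewrite mulr_sumr.
  have -> : expect p (fun w => #|[set b | (b \notin w) && two_arms_at S w b]|%:R)
    = \sum_b prob p (fun w => (b \notin w) && two_arms_at S w b).
    rewrite -expect_sum; apply: eq_expect => w.
    rewrite -sum1_card natr_sum big_mkcond; apply: eq_bigr => b _.
    by rewrite inE; case: ifP.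
  apply: eq_bigr => b _.
  have -> : prob p ((two_arms_at S)^~ b) = prob p (fun w => two_arms_at S (w :\ b) b).
    by apply: eq_expect => w; rewrite two_arms_at_D1.
  rewrite -(prob_closed p b (fun w => two_arms_at S w b)).
  by apply: eq_expect => w; rewrite two_arms_at_D1.
apply: le_trans (ler_expect p01 (fun w => touching_bound S w deg p01 l2 L0)) _.
rewrite !expectD !expectC expectZ expect_sum exploration_martingale.
under eq_bigr do rewrite exploration_martingale.
by rewrite sumr_const.
Qed.

End ArmBound.


(** ** Gluing two clusters *)

Definition clusters w := [set cluster w x | x in w].

Definition two_crossing B S w := [exists x in B, exists y in B,
  [&& cluster w x != cluster w y, meets (cluster w x) S &
      meets (cluster w y) S]].

Lemma clusterE w A x : A \in clusters w -> x \in A -> cluster w x = A.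
Proof. by case/imsetP => y _ -> /cluster_eq. Qed.

Lemma clusters_open w A x : A \in clusters w -> x \in A -> x \in w.
Proof. by case/imsetP => y _ ->; apply/subsetP/cluster_subl. Qed.

Lemma outer_closed w A x : A \in clusters w -> x \in outer A -> x \notin w.
Proof.
case/imsetP => y _ ->; rewrite inE => /andP[xA /existsP[z /andP[zy ezx]]].
by apply: contra xA => xw; apply: cluster_step ezx.
Qed.

Lemma clusters_neq w A A' x : A \in clusters w -> A' \in clusters w ->
  A != A' -> x \in A -> x \notin A'.
Proof.
move=> Ac Ac' AA' xA; apply: contra AA' => xA'.
by rewrite -(clusterE Ac xA) -(clusterE Ac' xA').
Qed.

Lemma outerP A z : reflect (z \notin A /\ exists2 y, y \in A & e y z) (z \in outer A).
Proof.
rewrite inE; apply: (iffP andP) => -[zA].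
  by case/existsP => y /andP[]; split=> //; exists y.
by case=> y yA yz; split=> //; apply/existsP; exists y; rewrite yA.
Qed.

Lemma cluster_depends U A x w w' : x \in A ->
  w :&: ((A :|: outer A) :&: U) = w' :&: ((A :|: outer A) :&: U) ->
  cluster (w :&: U) x = A -> cluster (w' :&: U) x = A.
Proof.
move=> xA ww clA; have clA' : reach (w :&: U) [set x] = A by rewrite reach_set1.
have fA : frontier [set x] A = outer A.
  by rewrite -clA frontier_set1 // -cluster_refl clA.
have := reach_cylinder (w :&: U) (w' :&: U) [set x].
have := reach_cylinder (w :&: U) (w :&: U) [set x].
rewrite eqxx clA' fA !reach_set1 => /esym/andP[AU OU] h.
have agree z : z \in A :|: outer A -> (z \in w' :&: U) = (z \in w :&: U).
  move=> zA; have /setP/(_ z) := ww; rewrite !in_setI zA /=.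
  by case: (z \in U); rewrite ?andbT ?andbF.
apply/eqP; rewrite h; apply/andP; split.
  apply/subsetP => z zA; rewrite agree; last by rewrite in_setU zA.
  exact: (subsetP AU).
apply/pred0P => z /=; have [zO|//] := boolP (z \in outer A).
by rewrite agree ?in_setU ?zO ?orbT // (disjointFr OU).
Qed.

Lemma clusters_depends A w w' :
  w :&: (A :|: outer A) = w' :&: (A :|: outer A) ->
  (A \in clusters w) = (A \in clusters w').
Proof.
suff imp u v : u :&: (A :|: outer A) = v :&: (A :|: outer A) ->
    A \in clusters u -> A \in clusters v.
  by move=> ww; apply/idP/idP; apply: imp; rewrite ww.
move=> uv /[dup] Au /imsetP[x xu AE]; have xA : x \in A by rewrite AE cluster_refl.
have := @cluster_depends setT A x u v xA; rewrite !setIT => h.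
have Av := h uv (esym AE); rewrite -Av; apply: imset_f.
by rewrite -cluster_refl Av.
Qed.

(** The open sites of [D] among those left undecided once [A1] and [A2] are known
    to be clusters. *)
Definition away A1 A2 D w :=
  (w :&: D) :\: (A1 :|: outer A1 :|: (A2 :|: outer A2)).

(** Opening the sites [a] and [b] would connect [A1] to [A2] inside [D]; they may
    coincide. *)
Definition nearly_joined A1 A2 D w :=
  [exists a in outer A1 :&: D, exists b in outer A2 :&: D,
     b \in cluster (a |: (b |: away A1 A2 D w)) a].

Lemma nearly_joinedP A1 A2 D w :
  reflect (exists a b, [/\ a \in outer A1, b \in outer A2, a \in D, b \in D &
                        b \in cluster (a |: (b |: away A1 A2 D w)) a])
          (nearly_joined A1 A2 D w).
Proof.
apply: (iffP existsP) => -[a].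
  case/andP; rewrite in_setI => /andP[aA aD] /existsP[b /andP[]].
  by rewrite in_setI => /andP[bA bD] ab; exists a, b.
case=> b [aA bA aD bD ab]; exists a; rewrite in_setI aA aD /=.
by apply/existsP; exists b; rewrite in_setI bA bD.
Qed.

(** A path from [A1] to [A2] in an unrelated configuration contains a stretch
    from [outer A1] to [outer A2] that avoids both sets and their boundaries. *)
Lemma path_nearly_joined A1 A2 D w x y :
  [disjoint A1 & A2] -> [disjoint outer A1 & A2] -> [disjoint outer A2 & A1] ->
  x \in A1 -> y \in A2 -> y \in cluster (w :&: D) x -> nearly_joined A1 A2 D w.
Proof.
move=> d12 do1 do2 xA1 yA2 yx; apply: contraLR (yx) => nJ.
set X := away A1 A2 D w.
pose Z := [set v | (v \in A1) ||
             [exists a in outer A1 :&: D, v \in cluster (a |: X) a]].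
have noZ v : v \in Z -> v \in D -> v \notin outer A2.
  rewrite inE => /orP[vA1 _|/existsP[a /andP[]]].
    by rewrite (disjointFl do2).
  rewrite in_setI => /andP[aA aD] va vD; apply: contra nJ => vA2.
  apply/nearly_joinedP; exists a, v; split=> //.
  by apply: subsetP va; apply: cluster_subX; apply: setUS; apply: subsetUr.
have ZA2 v : v \in Z -> v \notin A2.
  rewrite inE => /orP[vA1|/existsP[a /andP[]]]; first by rewrite (disjointFr d12).
  rewrite in_setI => /andP[aA aD] /(subsetP (cluster_subl _ _)).
  rewrite in_setU1 => /orP[/eqP->|]; first by rewrite (disjointFr do1).
  by rewrite !inE !negb_or => /andP[/andP[_ /andP[]]].
suff /subsetP sub : cluster (w :&: D) x \subset Z.
  by apply/negP => /sub/ZA2; rewrite yA2.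
apply: cluster_ind => [_|v z]; first by rewrite inE xA1.
rewrite !in_setI => /andP[vw vD] vZ /andP[zw zD] evz.
rewrite inE; have [//|zA1] := boolP (z \in A1).
have [zO|zO] := boolP (z \in outer A1); rewrite /=.
  by apply/existsP; exists z; rewrite in_setI zO zD cluster_refl setU11.
move: (vZ); rewrite inE => /orP[vA1|/existsP[a /andP[aO va]]].
  by case/negP: zO; apply/outerP; split=> //; exists v.
have vA2 := ZA2 v vZ.
have zA2 : z \notin A2.
  apply: contra (noZ v vZ vD) => zA2; apply/outerP; split=> //.
  by exists z => //; rewrite e_sym.
have zO2 : z \notin outer A2.
  apply: contra nJ => zO2; apply/nearly_joinedP.
  move: aO; rewrite in_setI => /andP[aO aD]; exists a, z; split=> //.
  apply: (@cluster_step _ _ v) => //; last by rewrite !in_setU1 eqxx orbT.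
  by apply: subsetP va; apply: cluster_subX; apply: setUS; apply: subsetUr.
apply/existsP; exists a; rewrite aO /=; apply: cluster_step va _ evz.
by rewrite in_setU1 in_setD !in_setU in_setI zw zD (negPf zA1) (negPf zO)
  (negPf zA2) (negPf zO2) orbT.
Qed.

Lemma meets_sub A A' S : A \subset A' -> meets A S -> meets A' S.
Proof.
move=> /subsetP AA /existsP[s /andP[sS sA]]; apply/existsP; exists s.
by rewrite sS AA.
Qed.

(** A site adjacent to both clusters serves as [a] and [b] at once.  Otherwise
    opening [a] attaches to [A1] the path up to [b], and [b] then separates the
    new cluster from [A2], which is left unchanged. *)
Lemma glue_two_arms w A1 A2 D S :
  A1 \in clusters w -> A2 \in clusters w -> A1 != A2 ->
  meets A1 S -> meets A2 S -> nearly_joined A1 A2 D w ->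
  exists a b, [/\ a \in outer A1, b \in outer A2, a \in D, b \in D &
               two_arms_at S (a |: w) b].
Proof.
move=> c1 c2 c12 m1 m2 /nearly_joinedP[a [b [aO bO aD bD ab]]].
have [/existsP[z /and3P[zO1 zO2 zD]]|no] :=
    boolP [exists z, [&& z \in outer A1, z \in outer A2 & z \in D]].
  exists z, z; split=> //; have zw := outer_closed c1 zO1.
  rewrite /two_arms_at setU1K //.
  case/outerP: zO1 => _ [x xA1 exz]; case/outerP: zO2 => _ [y yA2 eyz].
  apply/existsP; exists x; apply/existsP; exists y.
  by rewrite !(e_sym z) exz eyz (clusterE c1 xA1) (clusterE c2 yA2) c12 m1 m2.
have aO2 : a \notin outer A2.
  by apply: contra no => aO2; apply/existsP; exists a; rewrite aO aO2 aD.
have aw := outer_closed c1 aO; have bw := outer_closed c2 bO.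
have ba : b != a by apply: contraNneq aO2 => <-.
exists a, b; split=> //.
have wb : (a |: w) :\ b = a |: w.
  by apply/setDidPl; rewrite disjoint_sym disjoints1 in_setU1 negb_or ba.
set X := away A1 A2 D w in ab.
have Xw : X \subset w by apply: subset_trans (subsetDl _ _) (subsetIl _ _).
have /existsP[z /andP[za ezb]] : [exists z in cluster (a |: X) a, e z b].
  apply: contraLR ab => nz; apply/negP.
  suff /subsetP sub : cluster (a |: (b |: X)) a \subset cluster (a |: X) a.
    move=> /sub/(subsetP (cluster_subl _ _)); rewrite in_setU1 (negPf ba) /=.
    by move/(subsetP Xw); apply/negP.
  apply: cluster_ind => [_|u v _ ua]; first by rewrite cluster_refl setU11.
  rewrite !in_setU1 => /or3P[/eqP->|/eqP->|vX] euv.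
  - by rewrite cluster_refl setU11.
  - by case/existsP: nz; exists u; rewrite ua.
  - by apply: cluster_step ua _ euv; rewrite in_setU1 vX orbT.
have za' : z \in cluster (a |: w) a.
  by apply: subsetP za; apply: cluster_subX; apply: setUS.
case/outerP: aO => _ [x xA1 exa]; case/outerP: bO => _ [y yA2 eyb].
have yw := clusters_open c2 yA2; have xw := clusters_open c1 xA1.
have w'w : w \subset a |: w := subsetUr _ _.
have xa : x \in cluster (a |: w) a.
  apply: (@cluster_step _ _ a); rewrite ?cluster_refl ?setU11 ?(e_sym a) //.
  by rewrite in_setU1 xw orbT.
have cly : cluster (a |: w) y \subset A2.
  apply: cluster_ind => // u v _ uA2; rewrite in_setU1 => /orP[/eqP va|vw] euv.
    rewrite va in euv; case/negP: aO2; apply/outerP; split; last by exists u.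
    by apply: contra aw => /(clusters_open c2).
  by rewrite -(clusterE c2 uA2); apply: cluster_step euv; rewrite ?cluster_refl //
    (clusters_open c2).
rewrite /two_arms_at wb; apply/existsP; exists z; apply/existsP; exists y.
rewrite !(e_sym b) ezb eyb (cluster_eq za') /=; apply/and3P; split.
- apply: contra aw => /eqP cl; apply: (clusters_open c2); apply: (subsetP cly).
  by rewrite -cl cluster_refl setU11.
- rewrite -(cluster_eq xa); apply: meets_sub m1.
  by rewrite -(clusterE c1 xA1); apply: cluster_subX.
- apply: meets_sub m2; rewrite -(clusterE c2 yA2); exact: cluster_subX.
Qed.

Section Gluing.
Variable R : realType.
Implicit Types (p c : R).

Definition crossing_pair B S (A : {set V} * {set V}) w :=
  [&& A.1 \in clusters w, A.2 \in clusters w, A.1 != A.2 &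
      [&& meets A.1 B, meets A.2 B, meets A.1 S & meets A.2 S]].

(** Conditionally on two given clusters the configuration away from them is
    fresh, so the probability of nearly joining them is at least [c]. *)
Lemma prob_nearly_joined p c B D S (A : {set V} * {set V}) : 0 <= p <= 1 ->
  (forall x y, x \in B -> y \in B ->
     c <= prob p (fun w => y \in cluster (w :&: D) x)) ->
  c * prob p (crossing_pair B S A) <=
  prob p (fun w => crossing_pair B S A w && nearly_joined A.1 A.2 D w).
Proof.
move=> p01 hc; case: A => A1 A2.
have [/existsP[w0 cr0]|no] := boolP [exists w, crossing_pair B S (A1, A2) w]; last first.
  have -> : prob p (crossing_pair B S (A1, A2)) = 0.
    rewrite -[RHS](expectC V p); apply: eq_expect => w.
    by case: (boolP (crossing_pair _ _ _ w)) => // h; case/existsP: no; exists w.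
  by rewrite mulr0 prob_ge0.
case/and4P: (cr0) => /= c1 c2 c12 /and4P[m1 m2 _ _].
set W := A1 :|: outer A1 :|: (A2 :|: outer A2).
have K_dep : depends_on W (fun w => (crossing_pair B S (A1, A2) w)%:R : R).
  move=> w w' ww; rewrite /crossing_pair /=.
  have sub (W' : {set V}) : W' \subset W -> w :&: W' = w' :&: W'.
    by move=> /setIidPr <-; rewrite !setIA ww.
  rewrite (clusters_depends (sub _ (subsetUl _ _))).
  by rewrite (clusters_depends (sub _ (subsetUr _ _))).
have J_dep : depends_on (~: W) (fun w => (nearly_joined A1 A2 D w)%:R : R).
  move=> w w' ww; rewrite /nearly_joined; have -> : away A1 A2 D w = away A1 A2 D w'.
    by rewrite /away -/W !setDE -!setIA ![D :&: _]setIC !setIA ww.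
  by [].
have -> : prob p (fun w => crossing_pair B S (A1, A2) w && nearly_joined A1 A2 D w) =
    prob p (crossing_pair B S (A1, A2)) * prob p (nearly_joined A1 A2 D).
  rewrite /prob -(expect_indep p K_dep J_dep); apply: eq_expect => w.
  by rewrite -mulnb natrM.
rewrite mulrC ler_wpM2l ?prob_ge0 //.
case/existsP: m1 => x /andP[xB xA1]; case/existsP: m2 => y /andP[yB yA2].
apply: le_trans (hc x y xB yB) _; apply: prob_sub => // w.
have dis A A' : A \in clusters w0 -> A' \in clusters w0 -> A != A' ->
    [disjoint outer A & A'].
  move=> cA cA' AA'; apply/pred0P => z /=; apply/negP => /andP[zA zA'].
  by have := outer_closed cA zA; rewrite (clusters_open cA' zA').
apply: path_nearly_joined xA1 yA2; first last.
- by apply: dis; rewrite // eq_sym.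
- exact: dis.
apply/pred0P => z /=; apply/negP => /andP[zA zA'].
by have := clusters_neq c1 c2 c12 zA; rewrite zA'.
Qed.

(** The sum runs over pairs of clusters, not over pairs of sites of [B]: the
    expected number of crossing pairs bounds the probability that there is one,
    and each of them is nearly joined with probability at least [c].  Then some
    [a] of [D], once opened, makes some [b] of [D] a two-arm site; given [a] and
    [b], at most [Delta ^ 2] pairs of clusters are concerned. *)
Lemma gluing p c B D S (Delta : nat) :
  (forall x, #|[set y | e x y]| <= Delta)%N -> 0 <= p <= 1 -> 0 <= c ->
  (forall x y, x \in B -> y \in B ->
     c <= prob p (fun w => y \in cluster (w :&: D) x)) ->
  p * c * prob p (two_crossing B S) <=
  (Delta ^ 2 * #|D|)%:R * \sum_(b in D) prob p (fun w => two_arms_at S w b).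
Proof.
move=> deg p01 c0 hc.
have step1 : prob p (two_crossing B S) <= \sum_A prob p (crossing_pair B S A).
  rewrite -expect_sum; apply: ler_expect => // w.
  have [|_] := boolP (two_crossing B S w); last by rewrite sumr_ge0.
  case/existsP => x /andP[xB /existsP[y /and4P[yB xy mx my]]].
  rewrite (bigD1 (cluster w x, cluster w y)) //= /crossing_pair /= xy mx my.
  have xw : x \in w by case/existsP: mx => s /andP[_ /cluster_src].
  have yw : y \in w by case/existsP: my => s /andP[_ /cluster_src].
  have mB z : z \in B -> z \in w -> meets (cluster w z) B.
    by move=> zB zw; apply/existsP; exists z; rewrite zB cluster_refl.
  by rewrite !imset_f // !mB // lerDl sumr_ge0.
have step2 : c * prob p (two_crossing B S) <=
    \sum_A prob p (fun w => crossing_pair B S A w && nearly_joined A.1 A.2 D w).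
  apply: le_trans (ler_wpM2l c0 step1) _; rewrite mulr_sumr; apply: ler_sum => A _.
  exact: prob_nearly_joined.
have count_outer w a : (#|[set A in clusters w | a \in outer A]| <= Delta)%N.
  apply: (@card_imset_degree w Delta deg _ a) => A /andP[/imsetP[x _ ->]].
  exact: outer_nbr.
have step3 w :
    \sum_A (crossing_pair B S A w && nearly_joined A.1 A.2 D w)%:R <=
    \sum_(a in D) \sum_(b in D) (Delta ^ 2)%:R * (two_arms_at S (a |: w) b)%:R :> R.
  pose k a b (A : {set V} * {set V}) :=
    [&& A.1 \in clusters w, a \in outer A.1, A.2 \in clusters w & b \in outer A.2].
  apply: (@le_trans _ _ (\sum_A \sum_(a in D) \sum_(b in D)
      (k a b A)%:R * (two_arms_at S (a |: w) b)%:R)).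
    apply: ler_sum => -[A1 A2] _.
    have [|_] := boolP (_ && _); last first.
      by do 2![apply: sumr_ge0 => ? _]; apply: mulr_ge0.
    case/andP => /and4P[/= c1 c2 c12 /and4P[_ _ m1 m2]] J.
    have [a [b [aO bO aD bD arms]]] := glue_two_arms c1 c2 c12 m1 m2 J.
    pose F a b : R := (k a b (A1, A2))%:R * (two_arms_at S (a |: w) b)%:R.
    have F0 a' b' : 0 <= F a' b' by apply: mulr_ge0.
    have F1 : F a b = 1 by rewrite /F /k /= c1 c2 aO bO arms mulr1.
    apply: (@le_trans _ _ (F a b)); first by rewrite F1.
    apply: (@le_trans _ _ (\sum_(b in D) F a b)).
      by rewrite (bigD1 b bD) /= lerDl sumr_ge0.
    by rewrite [leRHS](bigD1 a aD) /= lerDl; do 2![apply: sumr_ge0 => ? _].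
  rewrite exchange_big; apply: ler_sum => a _; rewrite exchange_big.
  apply: ler_sum => b _; rewrite -mulr_suml ler_wpM2r // -natr_sum ler_nat.
  have -> : (\sum_A k a b A =
      #|setX [set A in clusters w | a \in outer A] [set A in clusters w | b \in outer A]|)%N.
    rewrite -sum1_card [RHS]big_mkcond; apply: eq_bigr => -[A1 A2] _.
    have -> : k a b (A1, A2) = ((A1, A2) \in setX [set A in clusters w | a \in outer A]
        [set A in clusters w | b \in outer A]).
      by rewrite /k in_setX /= !in_set -!andbA.
    exact: erefl.
  by rewrite cardsX expnS expn1 leq_mul.
rewrite -mulrA; apply: le_trans (ler_wpM2l _ step2) _; first by case/andP: p01.
rewrite -expect_sum; apply: le_trans (ler_wpM2l _ (ler_expect p01 step3)) _.
  by case/andP: p01.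
set T := \sum_(b in D) _.
have -> : (Delta ^ 2 * #|D|)%:R * T = \sum_(a in D) (Delta ^ 2)%:R * T.
  by rewrite sumr_const -mulr_natl natrM; ring.
rewrite expect_sum mulr_sumr; apply: ler_sum => a _.
rewrite expect_sum !mulr_sumr; apply: ler_sum => b _.
rewrite expectZ mulrCA ler_wpM2l //.
exact: (expect_open a p01 (f := fun w => (two_arms_at S w b)%:R)).
Qed.

End Gluing.


(** ** Leaving a box *)

(** After its last visit to the open cluster [A] of [o] in [U], a path leaves
    [U] by one step and then avoids [A] and its boundary. *)
Lemma last_exit w U T o : o \in U -> [disjoint U & T] ->
  meets (cluster w o) T ->
  let A := cluster (w :&: U) o in
  exists x y, [/\ x \in A, y \notin U, e x y &
               meets (cluster (w :\: ((A :|: outer A) :&: U)) y) T].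
Proof.
move=> oU UT mT A; set W := _ :&: U.
pose Z := A :|: [set v | [exists x in A, exists y,
  [&& y \notin U, e x y & v \in cluster (w :\: W) y]]].
suff /subsetP sub : cluster w o \subset Z.
  case/existsP: mT => t /andP[tT /sub]; rewrite in_setU => /orP[tA|].
    have : t \in w :&: U by apply: (subsetP (cluster_subl _ o)).
    by rewrite in_setI (disjointFl UT) // andbF.
  rewrite inE => /existsP[x /andP[xA /existsP[y /and3P[yU exy ty]]]].
  by exists x, y; split=> //; apply/existsP; exists t; rewrite tT.
apply: cluster_ind => [ow|v z vw vZ zw evz].
  by rewrite in_setU cluster_refl in_setI ow oU.
rewrite in_setU [z \in [set v | _]]inE; have [//|zA /=] := boolP (z \in A).
move: vZ; rewrite in_setU [v \in [set v | _]]inE => /orP[vA|].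
  have zU : z \notin U.
    apply: contra zA => zU; by apply: cluster_step vA _ evz; rewrite in_setI zw zU.
  apply/existsP; exists v; rewrite vA /=; apply/existsP; exists z.
  by rewrite zU evz cluster_refl in_setD in_setI (negPf zU) andbF zw.
case/existsP => x /andP[xA /existsP[y /and3P[yU exy vy]]].
apply/existsP; exists x; rewrite xA /=; apply/existsP; exists y.
rewrite yU exy /=; apply: cluster_step vy _ evz; rewrite in_setD zw andbT.
rewrite in_setI in_setU (negPf zA) /=; apply: contra zA => /andP[/outerP[_ [u uA euz]] zU].
by apply: cluster_step uA _ euz; rewrite in_setI zw.
Qed.

Section Simon.
Variable R : realType.

(** Simon's inequality.  Given the cluster of [o] in [U], the configuration off
    that cluster and its boundary is fresh, which makes the two factors
    independent. *)
Lemma simon (p : R) U T o : 0 <= p <= 1 -> o \in U -> [disjoint U & T] ->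
  prob p (fun w => meets (cluster w o) T) <=
  \sum_(x in U) prob p (fun w => x \in cluster (w :&: U) o) *
     \sum_(y | (y \notin U) && e x y) prob p (fun w => meets (cluster w y) T).
Proof.
move=> p01 oU UT.
pose W A := (A :|: outer A) :&: U.
pose K A w : R := ((o \in A) && (cluster (w :&: U) o == A))%:R.
pose G A y w : R := (meets (cluster (w :\: W A) y) T)%:R.
apply: (@le_trans _ _ (expect p (fun w => \sum_(A : {set V}) \sum_(x in A)
    \sum_(y | (y \notin U) && e x y) K A w * G A y w))).
  apply: ler_expect => // w; have [mT|_] := boolP (meets _ _); last first.
    by do 3![apply: sumr_ge0 => ? _]; apply: mulr_ge0.
  have [x [y [xA yU exy mT']]] := last_exit oU UT mT.
  set A := cluster (w :&: U) o in xA mT'.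
  have ow : o \in w by case/existsP: mT => t /andP[_ /cluster_src].
  have oA : o \in A by rewrite cluster_refl in_setI ow.
  have KA : K A w = 1 by rewrite /K oA eqxx.
  have GA : G A y w = 1 by rewrite /G mT'.
  have KG0 A' y' : 0 <= K A' w * G A' y' w by apply: mulr_ge0.
  apply: (@le_trans _ _ (K A w * G A y w)); first by rewrite KA GA mulr1.
  apply: (@le_trans _ _ (\sum_(y | (y \notin U) && e x y) K A w * G A y w)).
    by rewrite (bigD1 y) ?yU //= lerDl sumr_ge0.
  apply: (@le_trans _ _ (\sum_(x in A) \sum_(y | (y \notin U) && e x y) K A w * G A y w)).
    by rewrite [leRHS](bigD1 x) //= lerDl; do 2![apply: sumr_ge0 => ? _].
  by rewrite [leRHS](bigD1 A) //= lerDl; do 3![apply: sumr_ge0 => ? _].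
have KG A y : expect p (fun w => K A w * G A y w) <=
    expect p (K A) * prob p (fun w => meets (cluster w y) T).
  have KW : depends_on (W A) (K A).
    move=> w w' ww; rewrite /K; have [oA|//] := boolP (o \in A).
    congr (nat_of_bool _)%:R; rewrite /=; apply/idP/idP => /eqP h; apply/eqP;
      apply: (cluster_depends oA _ h).
      exact: ww.
    exact: esym.
  have GW : depends_on (~: W A) (G A y).
    by move=> w w' ww; rewrite /G !setDE ww.
  rewrite (expect_indep p KW GW) ler_wpM2l ?expect_ge0 //.
  apply: prob_sub => // w; apply: meets_sub; apply: cluster_subX.
  exact: subsetDl.
rewrite expect_sum; under eq_bigr => A _.
  rewrite expect_sum; under eq_bigr do rewrite expect_sum.
  over.
apply: (@le_trans _ _ (\sum_(A : {set V}) \sum_(x in A) \sum_(y | (y \notin U) && e x y)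
   expect p (K A) * prob p (fun w => meets (cluster w y) T))).
  by do 3![apply: ler_sum => ? _].
under eq_bigr do under eq_bigr do rewrite -mulr_sumr.
rewrite (exchange_big_dep predT) //= [leRHS]big_mkcond /=; apply: ler_sum => x _.
rewrite -mulr_suml.
have -> : \sum_(A : {set V} | x \in A) expect p (K A) =
    prob p (fun w => x \in cluster (w :&: U) o).
  rewrite -expect_sum; apply: eq_expect => w.
  have [xo|xo] := boolP (x \in _).
    rewrite (bigD1 (cluster (w :&: U) o)) //= big1 => [|A /andP[_ /negPf h]].
      by rewrite /K eqxx andbT cluster_refl (cluster_src xo) addr0.
    by rewrite /K eq_sym h andbF.
  rewrite big1 // => A xA; rewrite /K; case: eqP => [AE|_]; last by rewrite andbF.
  by rewrite AE xA in xo.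
case: ifP => // xU; suff -> : prob p (fun w => x \in cluster (w :&: U) o) = 0.
  by rewrite mul0r.
rewrite -[RHS](expectC V p); apply: eq_expect => w.
case: (boolP (x \in _)) => // /(subsetP (cluster_subl _ _)).
by rewrite in_setI xU andbF.
Qed.

End Simon.

End FiniteGraph.

Local Open Scope classical_set_scope.

(** * The lattice *)

Section LatticeGeometry.
Variable d : nat.
Implicit Types (x y z b c s t : site d) (w : configuration d) (A X : set (site d)).

Definition coord_dist x y (i : 'I_d) : nat := `|(x 0 i - y 0 i)%R|%N.

(** For integer points, distance one in the l1 norm is Euclidean distance one. *)
Definition nbr x y := (\sum_(i < d) coord_dist x y i)%N == 1%N.

Definition cube c m x := [forall i, (coord_dist x c i <= m)%N].

Lemma coord_distC x y i : coord_dist x y i = coord_dist y x i.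
Proof. rewrite /coord_dist; lia. Qed.

Lemma nbr_sym : symmetric nbr.
Proof.
by move=> x y; rewrite /nbr; congr (_ == _); apply: eq_bigr => i _;
  exact: coord_distC.
Qed.

Lemma sum_nat_eq1 (f : 'I_d -> nat) :
  ((\sum_i f i ^ 2)%N == 1%N) = ((\sum_i f i)%N == 1%N).
Proof.
have sq_id n : (n <= 1)%N -> (n ^ 2 = n)%N by case: n => [|[]].
have le_sum (g : 'I_d -> nat) i : (g i <= \sum_i g i)%N.
  by rewrite (bigD1 i) //= leq_addr.
apply/idP/idP => /eqP s1; rewrite -[X in _ == X]s1; apply/eqP;
  apply: eq_bigr => i _; rewrite sq_id //; last first.
  by rewrite -s1 le_sum.
by have := le_sum (fun i => f i ^ 2)%N i; rewrite s1; case: (f i) => [|[]].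
Qed.

Lemma neighborsE (R : realType) x y : neighbors R x y <-> nbr x y.
Proof.
rewrite /nbr -sum_nat_eq1 /neighbors /euclidean_dist.
have -> : \sum_(i < d) ((x 0 i)%:~R - (y 0 i)%:~R) ^+ 2 =
    (\sum_(i < d) coord_dist x y i ^ 2)%N%:R :> R.
  rewrite natr_sum; apply: eq_bigr => i _; rewrite natrX -rmorphB /=.
  rewrite -[(coord_dist x y i)%:R]/((Posz (coord_dist x y i))%:~R) abszE intr_norm.
  by rewrite real_normK // num_real.
set n := (\sum_i _)%N; split => [h|/eqP ->]; last by rewrite sqrtr1.
by rewrite -(eqr_nat R) -[n%:R]sqr_sqrtr ?ler0n // h expr1n.
Qed.

Lemma cubeP c m x : reflect (forall i, (coord_dist x c i <= m)%N) (cube c m x).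
Proof. exact: forallP. Qed.

Lemma cube_center c m : cube c m c.
Proof. by apply/cubeP => i; rewrite /coord_dist subrr. Qed.

Lemma cube_sub c c' m m' : (forall i, (coord_dist c' c i + m' <= m)%N) ->
  forall x, cube c' m' x -> cube c m x.
Proof.
move=> h x /cubeP hx; apply/cubeP => i; have := h i; have := hx i.
rewrite /coord_dist; lia.
Qed.

Lemma nbr_cube1 x y : nbr x y -> cube x 1 y.
Proof.
move=> /eqP xy; apply/cubeP => i; rewrite coord_distC -xy (bigD1 i) //=.
exact: leq_addr.
Qed.

(** ** Finite boxes *)

(** One finite type for all cubes of a given size: only [embed] sees the centre. *)
Definition boxsite m := {ffun 'I_d -> 'I_(2 * m).+1}.

Definition embed c m (f : boxsite m) : site d :=
  \row_i (c 0 i + (f i : nat)%:Z - m%:Z).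

Lemma embed_inj c m : injective (@embed c m).
Proof.
move=> f g /rowP fg; apply/ffunP => i; apply/val_inj => /=.
have := fg i; rewrite !mxE; lia.
Qed.

Lemma embed_cube c m f : cube c m (@embed c m f).
Proof. apply/cubeP => i; rewrite /coord_dist mxE; have := ltn_ord (f i); lia. Qed.

Lemma cube_embed c m x : cube c m x -> exists f, @embed c m f = x.
Proof.
move=> /cubeP xm; exists [ffun i => inord `|(x 0 i - c 0 i + m%:Z)%R|%N].
apply/rowP => i; have {}xm := xm i; rewrite /coord_dist in xm.
rewrite mxE ffunE inordK; lia.
Qed.

Definition nbr_box c m : rel (boxsite m) := fun f g => nbr (embed c f) (embed c g).

(** Neighbours differ by a vector with entries in [-1, 0, 1]. *)
Lemma card_nbr_box c m f : (#|[set g | @nbr_box c m f g]%SET| <= 3 ^ d)%N.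
Proof.
pose h (g : boxsite m) : {ffun 'I_d -> 'I_3} :=
  [ffun i => inord `|((g i : nat)%:Z - (f i : nat)%:Z + 1)%R|%N].
have -> : (3 ^ d = #|{ffun 'I_d -> 'I_3}|)%N by rewrite card_ffun !card_ord.
have hi : {in [set g | nbr_box c f g]%SET &, injective h}.
  move=> g g'; rewrite !inE => /nbr_cube1/cubeP fg /nbr_cube1/cubeP fg' /ffunP hh.
  apply/ffunP => i; apply: val_inj => /=; have := hh i; rewrite !ffunE.
  move/(congr1 (@nat_of_ord _)); have := fg i; have := fg' i; rewrite /coord_dist !mxE.
  move=> h1 h2; rewrite !inordK; lia.
by rewrite -(card_in_imset hi) max_card.
Qed.

Lemma card_boxsite m : #|{: boxsite m}| = ((2 * m).+1 ^ d)%N.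
Proof. by rewrite card_ffun !card_ord. Qed.

(** ** Connections *)

Definition adjacent X x y := [/\ X x, X y & nbr x y].

Definition connected_in X x y := X x /\ clos_refl_trans _ (adjacent X) x y.

Definition opened w : set (site d) := [set x | w x].

Definition boundary A := [set x | A x /\ exists y, ~ A y /\ nbr x y].

Definition meets_boundary A X x := exists s, boundary A s /\ connected_in X x s.

Definition arms A b w := let X := (A `&` opened w) `\ b in
  exists x y, [/\ nbr b x, nbr b y, ~ connected_in X x y,
                  meets_boundary A X x & meets_boundary A X y].

Lemma connected_ind X x (Z : set (site d)) : Z x ->
  (forall y z, X y -> X z -> Z y -> nbr y z -> Z z) ->
  forall y, connected_in X x y -> Z y.
Proof.
move=> Zx Zs y [_ /Operators_Properties.clos_rt_rtn1_iff h]; elim: h => //.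
move=> {}y z [Xy Xz yz] _ Zy.
exact: Zs yz.
Qed.

Lemma connected_refl X x : X x -> connected_in X x x.
Proof. by move=> Xx; split=> //; apply: rt_refl. Qed.

Lemma connected_step X x y z : connected_in X x y -> X y -> X z -> nbr y z ->
  connected_in X x z.
Proof.
by move=> [Xx xy] Xy Xz yz; split=> //; apply: rt_trans xy _; apply: rt_step.
Qed.

Lemma connected_mem X x y : connected_in X x y -> X y.
Proof. by move=> h; have [Xx _] := h; move: y h; apply: connected_ind. Qed.

Lemma connected_trans X x y z : connected_in X x y -> connected_in X y z ->
  connected_in X x z.
Proof. by move=> [Xx xy] [_ yz]; split=> //; apply: rt_trans yz. Qed.

Lemma connected_sym X x y : connected_in X x y -> connected_in X y x.
Proof.
move=> h; have [Xx _] := h; move: y h; apply: connected_ind => [|y z Xy Xz yx yz].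
  exact: connected_refl.
apply: connected_trans yx; apply: (@connected_step _ _ z) => //.
  exact: connected_refl.
by rewrite nbr_sym.
Qed.

Lemma connected_sub X Y x y : X `<=` Y -> connected_in X x y -> connected_in Y x y.
Proof.
move=> XY h; have [Xx _] := h; move: y h.
apply: connected_ind => [|y z Xy Xz yx yz]; first exact/connected_refl/XY.
by apply: connected_step yx _ _ yz; apply: XY.
Qed.

Lemma boundary_sub A A' x : A' `<=` A -> A' x -> boundary A x -> boundary A' x.
Proof.
by move=> AA A'x [_ [y [Ay xy]]]; split=> //; exists y; split=> // /AA.
Qed.

Lemma connected_or_exits A X x y : A x -> connected_in X x y ->
  meets_boundary A (X `&` A) x \/ (connected_in (X `&` A) x y /\ A y).
Proof.
move=> Ax xy; have [Xx _] := xy; move: y xy.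
apply: connected_ind; first by right; split=> //; apply: connected_refl.
move=> y z Xy Xz [|[xy Ay]] yz; first by left.
have [Az|Az] := pselect (A z); last first.
  by left; exists y; split=> //; split=> //; exists z.
by right; split=> //; apply: connected_step xy _ _ yz.
Qed.

Lemma meets_boundary_sub A A' X x : A' `<=` A -> A' x ->
  meets_boundary A X x -> meets_boundary A' (X `&` A') x.
Proof.
move=> AA A'x [s [sA xs]]; case: (connected_or_exits A'x xs) => // -[xs' A's].
by exists s; split=> //; apply: boundary_sub sA.
Qed.

(** In a smaller box the arms are shorter and still not connected. *)
Lemma arms_sub A A' b w : A' `<=` A -> (forall x, nbr b x -> A' x) ->
  arms A b w -> arms A' b w.
Proof.
move=> AA A'b [x [y [bx by_ xy mx my]]].
have XE : (A' `&` opened w) `\ b = ((A `&` opened w) `\ b) `&` A'.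
  by apply/seteqP; split=> z /= => [[[? ?] ?]|[[[? ?] ?] ?]]; do !split=> //; exact: AA.
exists x, y; split=> //; rewrite XE; first 1 last.
- by apply: meets_boundary_sub mx => //; apply: A'b.
- by apply: meets_boundary_sub my => //; apply: A'b.
by move=> h; apply: xy; apply: connected_sub h; apply: subIsetl.
Qed.

Lemma boundary_cube c m x : boundary (cube c m) x ->
  exists i, coord_dist x c i = m.
Proof.
move=> [/cubeP xc [y [yc /nbr_cube1/cubeP xy]]].
have [i hi] : exists i, ~~ (coord_dist y c i <= m)%N.
  by apply/existsP; rewrite -negb_forall; apply/negP.
exists i; have := xc i; have := xy i; move: hi; rewrite /coord_dist; lia.
Qed.

End LatticeGeometry.

(** ** Restriction to finitely many sites *)

Section Restriction.
Variables (d : nat) (V : finType) (f : V -> site d).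
Hypothesis f_inj : injective f.

Definition pull (w : configuration d) : {set V} := [set v | w (f v)]%SET.

Definition nbr_via : rel V := fun u v => nbr (f u) (f v).

Lemma nbr_via_sym : symmetric nbr_via.
Proof. by move=> u v; apply: nbr_sym. Qed.

Lemma cluster_connected (Y : set (site d)) (X : {set V}) u v :
  (forall v, (v \in X) = `[< Y (f v) >]) -> Y `<=` range f ->
  v \in cluster nbr_via X u <-> connected_in Y (f u) (f v).
Proof.
move=> XY Yf; split.
  pose Z := [set v | `[< connected_in Y (f u) (f v) >]]%SET.
  suff /fintype.subsetP sub : cluster nbr_via X u \subset Z.
    by move=> /sub; rewrite inE => /asboolP.
  apply: cluster_ind => [|y z]; rewrite !boot.finset.in_set !XY.
    by move=> /asboolP uY; apply/asboolP/connected_refl.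
  move=> /asboolP yY /asboolP uy /asboolP zY yz; apply/asboolP.
  exact: connected_step uy yY zY yz.
move=> uv; have [uY _] := uv.
pose Z := [set x | exists2 v, f v = x & v \in cluster nbr_via X u].
suff /(_ (f v) uv)[v' /f_inj ->] : forall x, connected_in Y (f u) x -> Z x by [].
apply: connected_ind => [|y z yY zY [v1 v1y uv1] yz].
  by exists u => //; rewrite cluster_refl XY; apply/asboolP.
have [v2 _ v2z] := Yf z zY; exists v2 => //; apply: cluster_step uv1 _ _.
  by rewrite XY v2z; apply/asboolP.
by rewrite /nbr_via v1y v2z.
Qed.

Variable A : set (site d).
Hypothesis rangef : range f = A.

Lemma pull_connected w u v :
  v \in cluster nbr_via (pull w) u <-> connected_in (A `&` opened w) (f u) (f v).
Proof.
apply: cluster_connected => [x|x []]; last by rewrite rangef.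
rewrite inE; apply/idP/asboolP => [wx|[]//]; split=> //.
by rewrite -rangef; exists x.
Qed.

Lemma pull_connected_in (U : {set V}) w u v :
  v \in cluster nbr_via (pull w :&: U) u <->
  connected_in ([set f x | x in [set` U]] `&` opened w) (f u) (f v).
Proof.
apply: cluster_connected => [x|x [[y _ <-]] _]; last by exists y.
rewrite !inE; apply/andP/asboolP => [[wx xU]|[[y yU /f_inj <-]]]; last by split.
by split=> //; exists x.
Qed.

Definition box_boundary : {set V} := [set v | `[< boundary A (f v) >]]%SET.

Lemma pull_meets w u :
  meets (cluster nbr_via (pull w) u) box_boundary <->
  meets_boundary A (A `&` opened w) (f u).
Proof.
split=> [/existsP[s /andP[]]|[s [sA us]]].
  by rewrite inE => /asboolP sA /pull_connected us; exists (f s).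
have [As _] := sA; rewrite -rangef in As; have [v _ vs] := As.
apply/existsP; exists v; rewrite inE vs; apply/andP; split; first exact/asboolP.
by apply/pull_connected; rewrite vs.
Qed.

Lemma pull_D1 w b v :
  (v \in (pull w :\ b)%SET) = `[< ((A `&` opened w) `\ f b) (f v) >].
Proof.
rewrite !inE; apply/andP/asboolP => [[vb wv]|[[_ wv] vb]]; last first.
  by split=> //; apply/eqP => vb'; apply: vb; rewrite vb'.
split; first by split=> //; rewrite -rangef; exists v.
by move=> /f_inj vb'; rewrite vb' eqxx in vb.
Qed.

Lemma pull_arms w b : (forall x, nbr (f b) x -> A x) ->
  two_arms_at nbr_via box_boundary (pull w) b <-> arms A (f b) w.
Proof.
move=> bA; set Y := (A `&` opened w) `\ f b.
have cl u v : v \in cluster nbr_via (pull w :\ b) u <-> connected_in Y (f u) (f v).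
  by apply: cluster_connected => [x|x [[Ax _] _]]; rewrite ?rangef // pull_D1.
have me u : meets (cluster nbr_via (pull w :\ b) u) box_boundary <->
    meets_boundary A Y (f u).
  split=> [/existsP[s /andP[]]|[s [sA us]]].
    by rewrite inE => /asboolP sA /cl us; exists (f s).
  have [As _] := sA; rewrite -rangef in As; have [v _ vs] := As.
  apply/existsP; exists v; rewrite inE vs; apply/andP; split; first exact/asboolP.
  by apply/cl; rewrite vs.
have neq u v : meets (cluster nbr_via (pull w :\ b) u) box_boundary ->
    meets (cluster nbr_via (pull w :\ b) v) box_boundary ->
    (cluster nbr_via (pull w :\ b) u != cluster nbr_via (pull w :\ b) v) <->
    ~ connected_in Y (f u) (f v).
  move=> mu mv; split=> [/eqP uv /cl h|uv].
    by apply: uv; rewrite (cluster_eq nbr_via_sym h).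
  apply/eqP => uvE; apply: uv; apply/cl; rewrite uvE cluster_refl.
  by case/existsP: mv => s /andP[_ /cluster_src].
split=> [/existsP[u /existsP[v /and5P[bu bv uv mu mv]]]|[x [y [bx by_ xy mx my]]]].
  exists (f u), (f v); split=> //; [exact/neq|exact/me|exact/me].
have [u _ ux] : range f x by rewrite rangef; apply: bA.
have [v _ vy] : range f y by rewrite rangef; apply: bA.
rewrite -ux -vy in bx by_ xy mx my.
apply/existsP; exists u; apply/existsP; exists v.
have mu : meets (cluster nbr_via (pull w :\ b) u) box_boundary by apply/me.
have mv : meets (cluster nbr_via (pull w :\ b) v) box_boundary by apply/me.
by apply/and5P; split=> //; apply/neq.
Qed.

End Restriction.

(** * Local events *)

Section LocalEvents.
Variables (R : realType) (d : nat) (p : R).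
Variable P : probability (percolation_space d) R.
Hypothesis p01 : 0 <= p <= 1.
Hypothesis Pp : site_percolation p P.
Implicit Types (E : set (configuration d)) (K : seq (site d)).

Definition supported K E := forall w w' : configuration d,
  {in K, w =1 w'} -> E w -> E w'.

Definition finite_event (V : finType) (f : V -> site d) (Q : pred {set V}) :
  set (configuration d) := [set w | Q (pull f w)].

Let cyl (s : {fset site d}) (t : seq (site d)) : set (percolation_space d) :=
  [set w : configuration d | (forall x, x \in s -> w x) /\ (forall x, x \in t -> ~~ w x)].

Lemma measurable_open x : measurable (open_at x : set (percolation_space d)).
Proof. by apply: sub_sigma_algebra; exists x. Qed.

Lemma measurable_cyl (s : {fset site d}) t : measurable (cyl s t).
Proof.
have -> : cyl s t = (\big[setI/setT]_(x <- s) open_at x) `&`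
    \big[setI/setT]_(x <- t) ~` open_at x.
  rewrite -!bigcap_seq; apply/seteqP; split=> w /=.
    case=> ws wt; split=> x /= h; first exact: ws.
    by apply/negP; apply: wt.
  case=> ws wt; split=> x h; first exact: ws.
  by apply/negP; apply: wt.
apply: measurableI; apply: bigsetI_measurable => x _.
  exact: measurable_open.
by apply: measurableC; apply: measurable_open.
Qed.

Lemma prob_cyl (s : {fset site d}) t : uniq t -> (forall x, x \in s -> x \notin t) ->
  P (cyl s t) = (p ^+ #|` s| * (1 - p) ^+ size t)%:E.
Proof.
have [Po Pi] := Pp.
elim: t s => [|z t IH] s /=.
  move=> _ _; have -> : cyl s [::] = \bigcap_(x in [set` s]) open_at x.
    by apply/seteqP; split=> w /=; [case=> ws _ x /= /ws|move=> ws; split=> // x /ws].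
  rewrite Pi expr0 mulr1.
  under eq_bigr do rewrite Po.
  by rewrite prodEFin big_const_seq iter_mulr mulr1 count_predT /= cardfE.
case/andP => zt ut st.
have zs : z \notin s by apply/negP => /st; rewrite mem_head.
have st' x : x \in s -> x \notin t by move=> /st; rewrite in_cons negb_or => /andP[].
have st2 x : x \in (z |` s)%fset -> x \notin t.
  by rewrite in_fset1U => /orP[/eqP -> //|/st'].
have E1 : cyl s t = cyl s (z :: t) `|` cyl (z |` s)%fset t.
  apply/seteqP; split=> w /=.
    case=> ws wt; have [wz|wz] := boolP (w z); [right|left]; split=> // x.
      by rewrite in_fset1U => /orP[/eqP ->|/ws].
    by rewrite in_cons => /orP[/eqP ->|/wt].
  case=> -[ws wt]; split=> x xs; first exact: ws.
  - by apply: wt; rewrite in_cons xs orbT.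
  - by apply: ws; rewrite in_fset1U xs orbT.
  - exact: wt.
have : P (cyl s t) = (P (cyl s (z :: t)) + P (cyl (z |` s)%fset t))%E.
  rewrite E1 measureU //; do 1?exact: measurable_cyl.
  apply/seteqP; split=> // w /= [[_ wt] [ws _]].
  by have := wt z (mem_head _ _); rewrite ws // fset1U1.
rewrite (IH s ut st') (IH _ ut st2) cardfsU1 zs /=.
have : P (cyl s (z :: t)) \is a fin_num by apply: fin_num_measure; apply: measurable_cyl.
case: (P (cyl s (z :: t))) => // r _; rewrite -EFinD => -[h]; congr EFin.
have -> : r = p ^+ #|` s| * (1 - p) ^+ size t -
    p ^+ (1 + #|` s|) * (1 - p) ^+ size t by rewrite h addrK.
by rewrite exprS exprD expr1; ring.
Qed.

Let atom (V : finType) (f : V -> site d) (v : {set V}) :=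
  cyl [fset f z | z in v]%fset [seq f z | z <- enum (~: v)%SET].

Lemma atomP (V : finType) (f : V -> site d) w (v : {set V}) :
  injective f -> atom f v w <-> pull f w = v.
Proof.
move=> f_inj; split=> [[wv wc]|<-].
  apply/setP => z; rewrite boot.finset.in_set; apply/idP/idP => [|zv].
    apply: contraLR => zv; apply: wc; apply: map_f.
    by rewrite mem_enum boot.finset.in_setC.
  by apply: wv; apply/imfsetP; exists z.
split=> x; first by move/imfsetP => [z /=]; rewrite boot.finset.in_set => wz ->.
by move/mapP => [z]; rewrite mem_enum boot.finset.in_setC boot.finset.in_set => ? ->.
Qed.

Lemma prob_atom (V : finType) (f : V -> site d) (v : {set V}) :
  injective f -> P (atom f v) = (weight p v)%:E.
Proof.
move=> f_inj; rewrite prob_cyl.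
- rewrite size_map -cardE card_imfset //= -cardE; congr EFin.
  rewrite /weight (bigID (fun z => z \in v)) /= -!prodr_const; congr (_ * _).
    by apply: eq_bigr => z ->.
  apply: eq_big => z; rewrite boot.finset.in_setC // => zv.
  by rewrite (negPf zv).
- by rewrite map_inj_uniq // enum_uniq.
- move=> x /imfsetP[z /= zv ->]; rewrite mem_map //.
  by rewrite mem_enum boot.finset.in_setC negbK.
Qed.

Lemma finite_event_atoms (V : finType) (f : V -> site d) (Q : pred {set V}) :
  injective f -> finite_event f Q = \big[setU/set0]_(v <- enum Q) atom f v.
Proof.
move=> f_inj; rewrite -bigcup_seq; apply/seteqP; split=> w /=.
  by move=> Qw; exists (pull f w) => /=; [rewrite mem_enum|apply/atomP].
by case=> v /=; rewrite mem_enum => Qv /(atomP _ _ f_inj); rewrite /finite_event /= => ->.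
Qed.

Lemma measurable_finite_event (V : finType) (f : V -> site d) (Q : pred {set V}) :
  injective f -> measurable (finite_event f Q : set (percolation_space d)).
Proof.
move=> f_inj; rewrite finite_event_atoms //.
by apply: bigsetU_measurable => v _; apply: measurable_cyl.
Qed.

(** The law of the states of finitely many sites does not depend on where the
    sites are: every invariance and restriction property comes from here. *)
Lemma prob_finite_event (V : finType) (f : V -> site d) (Q : pred {set V}) :
  injective f -> P (finite_event f Q) = (prob p Q)%:E.
Proof.
move=> f_inj; have -> : prob p Q = \sum_(v <- enum Q) weight p v.
  rewrite big_enum /= big_mkcond /=; apply: eq_bigr => v _.
  by rewrite unfold_in; case: (Q v); rewrite ?mulr1 ?mulr0.
rewrite finite_event_atoms //; elim: (enum Q) (enum_uniq Q) => [|v s IH] /=.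
  by rewrite !big_nil measure0.
case/andP => vs us; rewrite !big_cons measureU //.
- rewrite EFinD; congr (_ + _)%E; [exact: prob_atom|exact: IH].
- exact: measurable_cyl.
- by apply: bigsetU_measurable => u _; apply: measurable_cyl.
rewrite -bigcup_seq; apply/seteqP; split=> // w [/(atomP _ _ f_inj) wv].
by case=> u /= us' /(atomP _ _ f_inj) wu; rewrite -wv wu us' in vs.
Qed.

Definition extend (V : finType) (f : V -> site d) (v : {set V}) : configuration d :=
  fun x => [exists u in v, f u == x].

Lemma supported_finite_event (V : finType) (f : V -> site d) E :
  injective f -> supported (codom f) E ->
  E = finite_event f (fun v => `[< E (extend f v) >]).
Proof.
move=> f_inj sE; have ext w : {in codom f, w =1 extend f (pull f w)}.
  move=> x /codomP[u ->]; apply/idP/existsP => [wu|[v /andP[]]].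
    by exists u; rewrite boot.finset.in_set wu eqxx.
  by rewrite boot.finset.in_set => wv /eqP <-.
apply/seteqP; split=> w; rewrite /finite_event /=.
  by move=> Ew; apply/asboolP; apply: sE Ew.
by move=> /asboolP; apply: sE => x xf; rewrite (ext w x xf).
Qed.

Lemma codom_ssval K : codom (@ssval _ K) =i K.
Proof.
move=> x; apply/codomP/idP => [[u ->]|xK]; first exact: valP.
by exists (SeqSub xK).
Qed.

Lemma supported_codom K E : supported K E -> supported (codom (@ssval _ K)) E.
Proof. by move=> sE w w' ww; apply: sE => x xK; apply: ww; rewrite codom_ssval. Qed.

Lemma supportedE K E : supported K E ->
  exists Q : pred {set seq_sub K}, E = finite_event (@ssval _ K) Q.
Proof.
move=> /supported_codom sE; exists (fun v => `[< E (extend (@ssval _ K) v) >]).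
by apply: supported_finite_event sE; apply: val_inj.
Qed.

Lemma measurable_supported K E : supported K E ->
  measurable (E : set (percolation_space d)).
Proof.
by move=> /supportedE[Q ->]; apply: measurable_finite_event; apply: val_inj.
Qed.

Definition pr E : R := fine (P E).

Lemma prE K E : supported K E -> P E = (pr E)%:E.
Proof.
by move=> /measurable_supported mE; rewrite /pr fineK // fin_num_measure.
Qed.

Lemma pr_ge0 E : 0 <= pr E.
Proof. by rewrite /pr fine_ge0. Qed.

Lemma pr_finite_event (V : finType) (f : V -> site d) (Q : pred {set V}) :
  injective f -> pr (finite_event f Q) = prob p Q.
Proof. by move=> f_inj; rewrite /pr prob_finite_event. Qed.

Lemma pr_sub K K' E E' : supported K E -> supported K' E' -> E `<=` E' ->
  pr E <= pr E'.
Proof.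
move=> sE sE' EE; rewrite -lee_fin -(prE sE) -(prE sE').
by apply: le_measure => //; rewrite inE; [exact: measurable_supported sE|
  exact: measurable_supported sE'].
Qed.

Lemma pr_le1 K E : supported K E -> pr E <= 1.
Proof.
move=> sE; rewrite -lee_fin -(prE sE); apply: probability_le1.
exact: measurable_supported sE.
Qed.

Lemma pr_image K E (g : site d -> site d) : injective g -> supported K E ->
  pr [set w : configuration d | E (fun x => w (g x))] = pr E.
Proof.
move=> g_inj /supportedE[Q ->]; have s_inj : injective (@ssval _ K) := val_inj.
rewrite (pr_finite_event _ s_inj).
rewrite -(pr_finite_event (f := g \o @ssval _ K) Q) //.
exact: inj_comp.
Qed.

Definition increasing_event E := forall w w' : configuration d,
  (forall x, w x -> w' x) -> E w -> E w'.

Lemma harris_event K E E' : supported K E -> supported K E' ->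
  increasing_event E -> increasing_event E' -> pr E * pr E' <= pr (E `&` E').
Proof.
move=> /supported_codom sE /supported_codom sE' iE iE'.
have s_inj : injective (@ssval _ K) := val_inj.
have up (F : set (configuration d)) : increasing_event F ->
    increasing (fun v => `[< F (extend (@ssval _ K) v) >]%:R : R).
  move=> iF v v' /fintype.subsetP vv; rewrite ler_nat; case: asboolP => // Fv.
  rewrite lt0n eqb0 negbK; apply/asboolP; apply: iF Fv => x /existsP[u /andP[uv ux]].
  by apply/existsP; exists u; rewrite vv.
rewrite {1}(supported_finite_event s_inj sE) {1}(supported_finite_event s_inj sE').
have sEE : supported (codom (@ssval _ K)) (E `&` E').
  by move=> w w' ww [Ew Ew']; split; [apply: sE Ew|apply: sE' Ew'].
rewrite (supported_finite_event s_inj sEE) !pr_finite_event //.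
apply: le_trans (harris p01 (up _ iE) (up _ iE')) _.
by apply: ler_expect => // v; rewrite asbool_and -mulnb natrM.
Qed.

End LocalEvents.

Section Maps.
Variable d : nat.
Implicit Types (x y z b c u : site d) (w : configuration d).
Implicit Types (A X Y : set (site d)) (g : site d -> site d).

Lemma connected_map g X Y x y : (forall z, X z -> Y (g z)) ->
  (forall u v, nbr u v -> nbr (g u) (g v)) ->
  connected_in X x y -> connected_in Y (g x) (g y).
Proof.
move=> XY gn xy; have [Xx _] := xy; move: y xy.
apply: connected_ind => [|y z Xy Xz xy yz]; first exact/connected_refl/XY.
by apply: connected_step xy _ _ _; [exact: XY..|exact: gn].
Qed.

(** Translations, reflections and exchanges of axes are of this form, and map
    cubes to cubes. *)
Definition isometry g := exists s : {perm 'I_d}, forall x y k,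
  coord_dist (g x) (g y) k = coord_dist x y (s k).

Lemma isometry_inj g : isometry g -> injective g.
Proof.
move=> [s gs] x y gxy; apply/rowP => i.
have := gs x y (s^-1%g i); rewrite permKV gxy /coord_dist; lia.
Qed.

Lemma isometry_nbr g x y : isometry g -> nbr (g x) (g y) = nbr x y.
Proof.
move=> [s gs]; rewrite /nbr [in RHS](reindex_inj (@perm_inj _ s)) /=.
by congr (_ == _); apply: eq_bigr => k _.
Qed.

Lemma isometry_cube g c m x : isometry g -> cube (g c) m (g x) = cube c m x.
Proof.
move=> [s gs]; apply/cubeP/cubeP => h i; last by rewrite gs.
by have := h (s^-1%g i); rewrite gs permKV.
Qed.

Lemma isometry_translation u : isometry (fun x => x + u).
Proof.
by exists 1%g => x y k; rewrite perm1 /coord_dist !mxE; congr absz; ring.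
Qed.

(** Takes the origin to [u], and coordinate [i] with the sign [s] to the place [j]:
    a boundary site of a cube centred at the origin can be moved to any face. *)
Definition swap_flip u (i j : 'I_d) (s : int) x : site d :=
  \row_k (u 0 k + (if k == j then s else 1) * x 0 (tperm i j k)).

Lemma isometry_swap_flip u i j s : `|s|%N = 1%N -> isometry (swap_flip u i j s).
Proof.
move=> s1; exists (tperm i j) => x y k; rewrite /coord_dist !mxE.
case: ifP => _; last by congr absz; ring.
have -> : u 0 k + s * x 0 (tperm i j k) - (u 0 k + s * y 0 (tperm i j k)) =
  s * (x 0 (tperm i j k) - y 0 (tperm i j k)) by ring.
by rewrite abszM s1 mul1n.
Qed.

Definition cube_seq c m : seq (site d) := codom (@embed d c m).

Lemma mem_cube_seq c m x : (x \in cube_seq c m) = cube c m x.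
Proof.
apply/codomP/idP => [[f ->]|/cube_embed[f <-]]; first exact: embed_cube.
by exists f.
Qed.

Lemma range_embed c m : range (@embed d c m) = [set x | cube c m x].
Proof.
apply/seteqP; split=> x /=; first by case=> f _ <-; apply: embed_cube.
by case/cube_embed => f <-; exists f.
Qed.

Lemma size_cube_seq c m : size (cube_seq c m) = ((2 * m).+1 ^ d)%N.
Proof. by rewrite size_codom card_boxsite. Qed.

Lemma uniq_cube_seq c m : uniq (cube_seq c m).
Proof. by rewrite map_inj_uniq ?enum_uniq //; apply: embed_inj. Qed.

Definition cubeset c m : set (site d) := [set x | cube c m x].

(** ** Events of a finite region *)

Definition conn_event A x y : set (configuration d) :=
  [set w | connected_in (A `&` opened w) x y].

Definition exit_event A x : set (configuration d) :=
  [set w | meets_boundary A (A `&` opened w) x].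

Definition arms_event A b : set (configuration d) := [set w | arms A b w].

Lemma supported_region (K : seq (site d)) A (F : set (site d) -> Prop) :
  (forall x, A x -> x \in K) -> supported K [set w | F (A `&` opened w)].
Proof.
move=> AK w w' ww; rewrite /=; have -> // : A `&` opened w = A `&` opened w'.
by apply/seteqP; split=> x [Ax wx]; split=> //; move: wx; rewrite /opened /= ww //;
  apply: AK.
Qed.

Lemma supported_conn c m A x y : A `<=` cubeset c m ->
  supported (cube_seq c m) (conn_event A x y).
Proof.
move=> Ac; apply: (supported_region (F := fun X => connected_in X x y)).
by move=> z /Ac; rewrite mem_cube_seq.
Qed.

Lemma supported_exit c m A x : A `<=` cubeset c m ->
  supported (cube_seq c m) (exit_event A x).
Proof.
move=> Ac; apply: (supported_region (F := fun X => meets_boundary A X x)).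
by move=> z /Ac; rewrite mem_cube_seq.
Qed.

Lemma supported_arms c m A b : A `<=` cubeset c m ->
  supported (cube_seq c m) (arms_event A b).
Proof.
move=> Ac; apply: (supported_region (F := fun X => exists x y, [/\ nbr b x, nbr b y,
  ~ connected_in (X `\ b) x y, meets_boundary A (X `\ b) x
  & meets_boundary A (X `\ b) y])).
by move=> z /Ac; rewrite mem_cube_seq.
Qed.

Lemma supported_image (K : seq (site d)) (E : set (configuration d)) g :
  supported K E ->
  supported (map g K) [set w : configuration d | E (fun x => w (g x))].
Proof.
by move=> sE w w' ww; apply: sE => x xK; apply: ww; apply: map_f.
Qed.

Lemma conn_event_increasing A x y : increasing_event (conn_event A x y).
Proof.
move=> w w' ww; apply: connected_sub => z [Az wz]; split=> //; exact: ww.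
Qed.

End Maps.

Section LatticeProbability.
Variables (R : realType) (d : nat) (p : R).
Variable P : probability (percolation_space d) R.
Hypothesis p01 : 0 <= p <= 1.
Hypothesis Pp : site_percolation p P.
Implicit Types (x y z b c u : site d) (A : set (site d)).

Lemma pr_conn_isometry g c m x : isometry g ->
  pr P (conn_event (cubeset c m) c x) <=
  pr P (conn_event (cubeset (g c) m) (g c) (g x)).
Proof.
move=> gi; have g_inj := isometry_inj gi.
have s1 : supported (cube_seq c m) (conn_event (cubeset c m) c x).
  exact: supported_conn.
rewrite -(pr_image Pp g_inj s1).
apply: (pr_sub P (supported_image s1)).
  exact: (@supported_conn _ (g c) m).
move=> w; apply: connected_map => [z [zc wz]|u v].
  by split=> //; rewrite /cubeset /= isometry_cube.
by rewrite isometry_nbr.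
Qed.

Lemma boundary_isometry g c m x : isometry g -> boundary (cubeset c m) x ->
  boundary (cubeset (g c) m) (g x).
Proof.
move=> gi [xc [y [yc xy]]]; split; first by rewrite /cubeset /= isometry_cube.
by exists (g y); rewrite /cubeset /= isometry_cube // isometry_nbr.
Qed.

Lemma pr_exit_translation c c' m :
  pr P (exit_event (cubeset c m) c) = pr P (exit_event (cubeset c' m) c').
Proof.
suff le c1 c2 : pr P (exit_event (cubeset c1 m) c1) <=
    pr P (exit_event (cubeset c2 m) c2) by apply/eqP; rewrite eq_le !le.
pose g x : site d := x + (c2 - c1); have gi : isometry g := isometry_translation _.
have gc : g c1 = c2 by rewrite /g subrKC.
have s1 : supported (cube_seq c1 m) (exit_event (cubeset c1 m) c1).
  exact: supported_exit.
rewrite -(pr_image Pp (isometry_inj gi) s1).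
apply: (pr_sub P (supported_image s1)).
  exact: (@supported_exit _ c2 m).
move=> w [s [sb cs]]; rewrite -gc; exists (g s); split.
  exact: boundary_isometry.
apply: connected_map cs => [z [zc wz]|u v]; last by rewrite isometry_nbr.
by split=> //; rewrite /cubeset /= isometry_cube.
Qed.

Lemma pr_arms_translation c c' m :
  pr P (arms_event (cubeset c m) c) = pr P (arms_event (cubeset c' m) c').
Proof.
suff le c1 c2 : pr P (arms_event (cubeset c1 m) c1) <=
    pr P (arms_event (cubeset c2 m) c2) by apply/eqP; rewrite eq_le !le.
pose g x : site d := x + (c2 - c1); have gi : isometry g := isometry_translation _.
pose h x : site d := x + (c1 - c2); have hi : isometry h := isometry_translation _.
have gc : g c1 = c2 by rewrite /g subrKC.
have hg x : h (g x) = x by rewrite /h /g -(opprB c2 c1) addrK.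
have gh x : g (h x) = x by rewrite /h /g -(opprB c1 c2) addrK.
have s1 : supported (cube_seq c1 m) (arms_event (cubeset c1 m) c1).
  exact: supported_arms.
rewrite -(pr_image Pp (isometry_inj gi) s1).
apply: (pr_sub P (supported_image s1)).
  exact: (@supported_arms _ c2 m).
move=> w [x [y [bx by_ xy mx my]]].
have fwd z : ((cubeset c1 m `&` opened (fun x => w (g x))) `\ c1) z ->
    ((cubeset c2 m `&` opened w) `\ c2) (g z).
  case=> -[zc wz] zc1; split; first by split=> //; rewrite -gc /cubeset /= isometry_cube.
  by move=> gz; apply: zc1; rewrite -(hg z) [g z]gz -gc hg.
have meet z : meets_boundary (cubeset c1 m)
      ((cubeset c1 m `&` opened (fun x => w (g x))) `\ c1) z ->
    meets_boundary (cubeset c2 m) ((cubeset c2 m `&` opened w) `\ c2) (g z).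
  move=> [s [sb zs]]; exists (g s); split; first by rewrite -gc; apply: boundary_isometry.
  by apply: connected_map zs => // u v; rewrite isometry_nbr.
exists (g x), (g y); split; [| | |exact: meet|exact: meet].
- by rewrite -gc isometry_nbr.
- by rewrite -gc isometry_nbr.
move=> gxy; apply: xy; rewrite -(hg x) -(hg y).
apply: connected_map gxy => [z [[zc wz] zc2]|u v]; last by rewrite isometry_nbr.
split; last by move=> hz; apply: zc2; rewrite -(gh z) hz gc.
split; last by rewrite /opened /= gh.
by rewrite /cubeset /= -(isometry_cube _ _ _ gi) gc gh.
Qed.

End LatticeProbability.

Section BoxEstimates.
Variables (R : realType) (d : nat) (p : R).
Variable P : probability (percolation_space d) R.
Hypothesis p01 : 0 <= p <= 1.
Hypothesis Pp : site_percolation p P.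
Implicit Types (x y z b c u : site d) (A : set (site d)) (m n : nat).

Lemma prob_meets_boundary c m (u : boxsite d m) :
  prob p (fun w => meets (cluster (nbr_via (embed c (m:=m))) w u)
                     (box_boundary (embed c (m:=m)) (cubeset c m))) =
  pr P (exit_event (cubeset c m) (embed c u)).
Proof.
rewrite -(pr_finite_event Pp _ (@embed_inj _ c m)); congr (pr P _).
by apply/seteqP; split=> w /(pull_meets (@embed_inj _ c m) (range_embed c m)).
Qed.

Lemma prob_connected c m (U : {set boxsite d m}) A (u v : boxsite d m) :
  [set embed c x | x in [set` U]] = A ->
  prob p (fun w => v \in cluster (nbr_via (embed c (m:=m))) (w :&: U) u) =
  pr P (conn_event A (embed c u) (embed c v)).
Proof.
move=> <-; rewrite -(pr_finite_event Pp _ (@embed_inj _ c m)); congr (pr P _).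
by apply/seteqP; split=> w /(pull_connected_in (@embed_inj _ c m) U w u v).
Qed.

Lemma prob_two_arms c m (b : boxsite d m) :
  (forall x, nbr (embed c b) x -> cubeset c m x) ->
  prob p (fun w => two_arms_at (nbr_via (embed c (m:=m)))
                     (box_boundary (embed c (m:=m)) (cubeset c m)) w b) =
  pr P (arms_event (cubeset c m) (embed c b)).
Proof.
move=> bA; rewrite -(pr_finite_event Pp _ (@embed_inj _ c m)); congr (pr P _).
by apply/seteqP; split=> w /(pull_arms (@embed_inj _ c m) (range_embed c m) w bA).
Qed.

Definition subcube c m c' m' : {set boxsite d m} :=
  [set v | cube c' m' (embed c v)]%SET.

Lemma image_subcube c m c' m' : cubeset c' m' `<=` cubeset c m ->
  [set embed c x | x in [set` subcube c m c' m']] = cubeset c' m'.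
Proof.
move=> sub; apply/seteqP; split=> x /=.
  by case=> v; rewrite /= boot.finset.in_set => vc <-.
move=> xc'; have /cube_embed[v vx] := sub x xc'.
by exists v => //=; rewrite boot.finset.in_set vx.
Qed.

Lemma sum_boxsite c m (F : site d -> R) (Q : pred (site d)) :
  \sum_(v : boxsite d m | Q (embed c v)) F (embed c v) =
  \sum_(x <- cube_seq c m | Q x) F x.
Proof. by rewrite /cube_seq /codom big_image_cond. Qed.

(** Expected number of boundary sites of the cube connected to its centre. *)
Definition boundary_flux n : R :=
  \sum_(x <- cube_seq 0 n | `[< boundary (cubeset 0 n) x >])
    pr P (conn_event (cubeset 0 n) 0 x).

Definition exit_prob m : R := pr P (exit_event (cubeset 0 m) 0).

Lemma cubeset_sub c c' m m' : (forall i, (coord_dist c' c i + m' <= m)%N) ->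
  cubeset c' m' `<=` cubeset c m.
Proof. by move=> h x; apply: cube_sub. Qed.

Lemma coord_dist_refl x i : coord_dist x x i = 0%N.
Proof. by rewrite /coord_dist subrr. Qed.

(** Only the boundary sites of the small cube have neighbours outside it, and a
    path from such a neighbour to the boundary of the large cube leaves a
    translated cube of half-side [m - n.+1]. *)
Lemma exit_prob_step n m : (n < m)%N ->
  exit_prob m <= (3 ^ d)%:R * boundary_flux n * exit_prob (m - n.+1).
Proof.
move=> nm; set V := boxsite d m; pose f : V -> site d := embed 0 (m:=m).
have f_inj : injective f := @embed_inj _ _ _.
have [v0 fo] : exists v, f v = 0 by apply: cube_embed; apply: cube_center.
pose e := nbr_via f; pose T := box_boundary f (cubeset 0 m).
pose U := subcube 0 m 0 n.
have sub_nm : cubeset (0 : site d) n `<=` cubeset 0 m.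
  by apply: (@cubeset_sub 0 0 m n) => i; rewrite coord_dist_refl add0n ltnW.
have UA : [set f x | x in [set` U]] = cubeset 0 n by apply: image_subcube.
have oU : v0 \in U by rewrite boot.finset.in_set -/(f v0) fo cube_center.
have UT : [disjoint U & T]%B.
  apply/pred0P => v /=; apply/negP => /andP[]; rewrite !boot.finset.in_set -/(f v).
  move=> /cubeP vn /asboolP/boundary_cube[i vi]; have := vn i.
  by rewrite vi leqNgt nm.
have ex v : prob p (fun w => meets (cluster e w v) T) =
    pr P (exit_event (cubeset 0 m) (f v)) by apply: prob_meets_boundary.
have -> : exit_prob m = prob p (fun w => meets (cluster e w v0) T) by rewrite ex fo.
apply: le_trans (simon e p01 oU UT) _.
have exit_le (x y : V) : x \in U -> e x y -> prob p (fun w => meets (cluster e w y) T) <=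
    exit_prob (m - n.+1).
  rewrite boot.finset.in_set -/(f x) => /cubeP xn /nbr_cube1/cubeP xy.
  have sub : cubeset (f y) (m - n.+1) `<=` cubeset 0 m.
    apply: (@cubeset_sub 0 (f y) m (m - n.+1)) => i; have := xn i; have := xy i.
    by rewrite /coord_dist; lia.
  rewrite ex /exit_prob (pr_exit_translation Pp 0 (f y)).
  have s1 := @supported_exit _ 0 m (cubeset 0 m) (f y) (@subset_refl _ _).
  have s2 := @supported_exit _ _ _ _ (f y) (@subset_refl _ (cubeset (f y) (m - n.+1))).
  apply: (pr_sub P s1 s2).
  move=> w /(meets_boundary_sub sub) h; have {h} := h (cube_center _ _).
  congr (meets_boundary _ _ _); rewrite setIAC; congr (_ `&` _).
  by apply/setIidPr.
have deg (x : V) := @card_nbr_box d 0 m x.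
have exit_ge0 : 0 <= exit_prob (m - n.+1) by apply: pr_ge0.
apply: (@le_trans _ _ (\sum_(v | `[< boundary (cubeset 0 n) (f v) >])
    pr P (conn_event (cubeset 0 n) 0 (f v)) * ((3 ^ d)%:R * exit_prob (m - n.+1)))).
  rewrite (bigID (fun v => `[< boundary (cubeset 0 n) (f v) >])) /=.
  rewrite [X in _ + X]big1 ?addr0 => [|x /andP[xU xb]]; last first.
    rewrite big1 ?mulr0 // => y /andP[yU xy]; case/asboolP: xb.
    split; first by rewrite -UA; exists x.
    exists (f y); split=> //; rewrite -UA => -[y' /= y'U /f_inj yy].
    by rewrite -yy y'U in yU.
  apply: (@le_trans _ _ (\sum_(v in U | `[< boundary (cubeset 0 n) (f v) >])
    pr P (conn_event (cubeset 0 n) 0 (f v)) * ((3 ^ d)%:R * exit_prob (m - n.+1)))).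
    apply: ler_sum => x /andP[xU _]; rewrite (prob_connected v0 x UA) -/(f v0) fo.
    rewrite ler_wpM2l ?pr_ge0 //.
    apply: (@le_trans _ _ (\sum_(v in [set v | e x v]%SET) exit_prob (m - n.+1))).
      rewrite [leRHS](bigID (fun v => v \in U)) /= addrC.
      apply: (@le_trans _ _ (\sum_(v in [set v | e x v]%SET | v \notin U) exit_prob (m - n.+1))).
        rewrite [leRHS](eq_bigl (fun v => (v \notin U) && e x v)); last first.
          by move=> y; rewrite boot.finset.in_set andbC.
        by apply: ler_sum => y /andP[_ xy]; apply: exit_le xy.
      by rewrite lerDl sumr_ge0.
    by rewrite sumr_const -[leLHS]mulr_natl ler_wpM2r // ler_nat; apply: deg.
  rewrite [leRHS](bigID (fun v => v \in U)) /=.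
  rewrite [X in X + _](eq_bigl (fun v => (v \in U) && `[< boundary (cubeset 0 n) (f v) >])).
    by rewrite lerDl sumr_ge0 // => v _; rewrite !mulr_ge0 ?pr_ge0.
  by move=> v; rewrite andbC.
rewrite -mulr_suml mulrA ler_wpM2r // [leLHS]mulrC ler_wpM2l //.
rewrite (sum_boxsite 0 m (fun x => pr P (conn_event (cubeset 0 n) 0 x))
  (fun x => `[< boundary (cubeset 0 n) x >])).
rewrite /boundary_flux -[leLHS]big_filter -[leRHS]big_filter le_eqVlt.
apply/orP; left; apply/eqP/perm_big.
apply: uniq_perm; rewrite ?filter_uniq ?uniq_cube_seq // => x.
rewrite !mem_filter !mem_cube_seq; case: asboolP => //= -[xn _].
by rewrite (sub_nm x xn) xn.
Qed.

End BoxEstimates.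

(** * The critical point *)

Section Percolates.
Variables (R : realType) (d : nat).
Implicit Types (x y z : site d) (w : configuration d) (A : set (site d)).

Lemma adjacent_inE A : adjacent_in R A = @adjacent d A.
Proof.
apply/funext => x; apply/funext => y; apply/propext.
by split=> -[? ? /neighborsE xy].
Qed.

(** Percolation is thereby measurable, and at most as likely as leaving any given
    cube. *)
Lemma origin_percolatesE :
  @origin_percolates R d = \bigcap_m exit_event (cubeset 0 m) 0.
Proof.
apply/seteqP; split=> w /=.
  move=> [C [[x [_ wx] CE] C0 infC]] m _.
  rewrite adjacent_inE in CE; move: C0 infC; rewrite {C}CE /= => x0 infC.
  have c0 : connected_in (opened w) 0 x.
    by apply: connected_sym; split=> //; move: x0; rewrite /open_sites setTI.
  have [y xy ym] : exists2 y, connected_in (opened w) x y & ~ cubeset 0 m y.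
    apply: contra_notP infC => far; apply: (@sub_finite_set _ _ [set` cube_seq 0 m]).
      move=> y /=; rewrite /open_sites setTI mem_cube_seq => xy.
      by apply: contra_notP far => ym; exists y.
    exact: finite_seq.
  have m0 : cubeset 0 m (0 : site d) by apply: cube_center.
  rewrite /exit_event /= setIC.
  by case: (connected_or_exits m0 (connected_trans c0 xy)) => // -[].
move=> ex; have [s [_ s0]] := ex 0%N I.
have w0 : w 0 by case: s0 => -[].
exists [set y | clos_refl_trans _ (adjacent (opened w)) 0 y]; split=> /=.
- by exists 0; [split|rewrite adjacent_inE /open_sites setTI].
- exact: rt_refl.
move=> /finite_seqP[r rE].
pose m := (\sum_(x <- r) \sum_i coord_dist x (0%R : site d) i).+1.
have [t [/boundary_cube[i ti] t0]] := ex m I.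
have : t \in r.
  suff : [set` r] t by [].
  by rewrite -rE /=; have [] := connected_sub (@subIsetr _ _ _) t0.
move=> tr; have : (coord_dist t 0%R i <= m.-1)%N.
  rewrite /m /= (big_rem t tr) /= (bigD1 i) //= -addnA; exact: leq_addr.
by rewrite ti /m /= ltnn.
Qed.

Lemma measurable_origin_percolates :
  measurable (@origin_percolates R d : set (percolation_space d)).
Proof.
rewrite origin_percolatesE; apply: bigcapT_measurable => m.
exact: measurable_supported (@supported_exit _ 0 m _ 0 (@subset_refl _ _)).
Qed.

End Percolates.

Section Criterion.
Variables (R : realType) (d : nat).
Implicit Types (p : R) (n : nat).

(** By [exit_prob_step] the probability to leave a cube is halved each time its
    half-side grows by [n.+1]. *)
Lemma small_flux_subcritical p (P : probability (percolation_space d) R) n :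
  0 <= p <= 1 -> site_percolation p P ->
  (3 ^ d)%:R * boundary_flux P n <= 2^-1 -> P (@origin_percolates R d) = 0%E.
Proof.
move=> p01 Pp small.
have decay k : exit_prob P (k * n.+1) <= 2^-1 ^+ k.
  elim: k => [|k IH].
    exact: pr_le1 (@supported_exit _ 0 0 _ 0 (@subset_refl _ _)).
  apply: le_trans (exit_prob_step p01 Pp (n := n) _) _.
    by rewrite mulSn addSn ltnS leq_addr.
  rewrite mulSn addKn exprS; apply: ler_pM; rewrite ?pr_ge0 //.
  by rewrite mulr_ge0 // sumr_ge0 // => x _; apply: pr_ge0.
have le_exit m : (P (@origin_percolates R d) <= (exit_prob P m)%:E)%E.
  have s := @supported_exit d 0 m _ 0 (@subset_refl _ _).
  rewrite -(prE P s); apply: le_measure.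
  - by rewrite inE; apply: measurable_origin_percolates.
  - by rewrite inE; apply: measurable_supported s.
  - by rewrite origin_percolatesE => w /(_ m I).
have : P (@origin_percolates R d) \is a fin_num.
  by apply: fin_num_measure; apply: measurable_origin_percolates.
have : (0 <= P (@origin_percolates R d))%E by apply: measure_ge0.
case: (P _) le_exit => // r le_exit r_ge0 _.
have : 0 <= r by rewrite -lee_fin.
rewrite le_eqVlt => /orP[/eqP <- //|r0].
have r_le k : r * 2 ^+ k <= 1.
  have : r <= 2^-1 ^+ k by apply: le_trans (decay k); rewrite -lee_fin.
  by rewrite exprVn -[_ ^-1]div1r ler_pdivlMr ?exprn_gt0.
have := archi_boundP (ltW (_ : 0 < r^-1)); rewrite invr_gt0 => /(_ r0).
set k := Num.bound _ => rk; have := r_le k; rewrite leNgt => /negP[].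
apply: (@lt_le_trans _ _ (r * k%:R)); first by rewrite mulrC -ltr_pdivrMr // div1r.
by rewrite (ler_wpM2l (ltW r0)) // -natrX ler_nat ltnW // ltn_expl.
Qed.

(** Probabilities of local events are polynomials in [p], hence continuous. *)
Definition prob_poly (V : finType) (Q : pred {set V}) : {poly R} :=
  \sum_(w : {set V} | Q w) \prod_z (if z \in w then 'X else 1 - 'X).

Lemma prob_polyE (V : finType) (Q : pred {set V}) p : prob p Q = (prob_poly Q).[p].
Proof.
rewrite /prob_poly horner_sum big_mkcond /=; apply: eq_bigr => w _.
case: (Q w); last by rewrite mulr0.
rewrite mulr1 horner_prod; apply: eq_bigr => z _.
by case: (z \in w); rewrite !hornerE.
Qed.

Variable P : R -> probability (percolation_space d) R.
Hypothesis hP : forall p, 0 <= p <= 1 -> site_percolation p (P p).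

Lemma flux_poly n : exists F : {poly R},
  forall p, 0 <= p <= 1 -> boundary_flux (P p) n = F.[p].
Proof.
pose Q x := fun v => `[< conn_event (cubeset 0 n) 0 x (extend (embed (0 : site d) (m:=n)) v) >].
exists (\sum_(x <- cube_seq 0 n | `[< boundary (cubeset 0 n) x >]) prob_poly (Q x)).
move=> p p01; rewrite horner_sum; apply: eq_bigr => x _; rewrite -prob_polyE.
rewrite -(pr_finite_event (hP p01) (Q x) (@embed_inj _ 0 n)).
rewrite -supported_finite_event //; first exact: embed_inj.
exact: supported_conn.
Qed.

Let pc := critical_probability P.

Lemma critical_probability_bounds : 0 <= pc <= 1.
Proof.
rewrite /pc /critical_probability; set S := [set p | _].
have ub : ubound S 1 by move=> p [/andP[]].
have [S0|/set0P/negP/negPn/eqP ->] := pselect (S !=set0); last by rewrite sup0 lexx ler01.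
apply/andP; split; last exact: ge_sup.
have [p pS] := S0; have [/andP[p0 _] _] := pS; apply: le_trans p0 _.
by apply: ub_le_sup pS; exists 1.
Qed.

(** At criticality the flux through the boundary of any cube is bounded below:
    otherwise, by continuity, it would still be small slightly above [pc], and
    there would be no percolation there. *)
Lemma critical_flux n : pc < 1 -> 2^-1 <= (3 ^ d)%:R * boundary_flux (P pc) n.
Proof.
move=> pc1; have pc01 := critical_probability_bounds.
rewrite leNgt; apply/negP => small.
have [F FE] := flux_poly n; pose G := (3 ^ d)%:R *: F.
have GE p : 0 <= p <= 1 -> (3 ^ d)%:R * boundary_flux (P p) n = G.[p].
  by move=> p01; rewrite FE // hornerZ.
rewrite GE // in small.
have /cvgr_lt/(_ _ small) := @continuous_horner R G pc.
move/nbhs_ballP => [r /= r0 near].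
pose p := Num.min 1 (pc + r / 2).
have pcp : pc < p by rewrite lt_min pc1 ltrDl divr_gt0.
have p01 : 0 <= p <= 1.
  by rewrite ge_min lexx /= andbT (le_trans _ (ltW pcp)); case/andP: pc01.
have /near Gp : ball_ Num.norm pc r p.
  rewrite /ball_ /= distrC gtr0_norm ?subr_gt0 // ltrBlDl.
  rewrite gt_min; apply/orP; right; rewrite ltrD2l ltr_pdivrMr // ltr_pMr //; lra.
have : theta P p = 0%E.
  by apply: (small_flux_subcritical p01 (hP p01) (n := n)); rewrite GE // ltW.
move=> tp; have : p <= pc.
  by apply: ub_le_sup; [exists 1 => q [/andP[]]|split].
by rewrite leNgt pcp.
Qed.

End Criterion.

(** * Connections inside a box at criticality *)

Section BoundaryCount.
Variable d : nat.

Lemma card_slice m (i : 'I_d) (a : 'I_(2 * m).+1) :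
  (#|[set v : boxsite d m | v i == a]%SET| <= (2 * m).+1 ^ d.-1)%N.
Proof.
rewrite -(@leq_pmul2r (2 * m).+1) // -expnSr prednK; last first.
  exact: leq_ltn_trans (ltn_ord i).
(* changing the coordinate [i] arbitrarily is injective on the slice *)
pose g (vb : boxsite d m * 'I_(2 * m).+1) : boxsite d m :=
  [ffun k => if k == i then vb.2 else vb.1 k].
have g_inj : {in boot.finset.setX [set v : boxsite d m | v i == a]%SET [set: 'I_(2 * m).+1]%SET &,
    injective g}.
  move=> [v b] [v' b'] /boot.finset.setXP[va _] /boot.finset.setXP[va' _] /ffunP gg.
  rewrite boot.finset.in_set in va; rewrite boot.finset.in_set in va'.
  have -> : b = b' by have := gg i; rewrite !ffunE eqxx.
  congr pair; apply/ffunP => k; have := gg k; rewrite !ffunE /=.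
  by case: eqP => // -> _; rewrite (eqP va) (eqP va').
have := card_in_imset g_inj; rewrite boot.finset.cardsX boot.finset.cardsT card_ord => <-.
by rewrite -card_boxsite max_card.
Qed.

Lemma card_box_boundary (c : site d) m :
  (#|box_boundary (embed c (m:=m)) (cubeset c m)| <=
     2 * d * (2 * m).+1 ^ d.-1)%N.
Proof.
pose slice (ia : 'I_d * bool) : {set boxsite d m} :=
  [set v : boxsite d m | v ia.1 == if ia.2 then ord0 else ord_max]%SET.
apply: (@leq_trans #|\bigcup_ia slice ia|%SET).
  apply/subset_leq_card/fintype.subsetP => v.
  rewrite boot.finset.in_set => /asboolP/boundary_cube[i].
  rewrite /coord_dist mxE => vi; apply/boot.finset.bigcupP.
  exists (i, (v i : nat) == 0%N) => //; rewrite boot.finset.in_set /=.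
  have [k kE] : exists k, nat_of_ord (v i) = k by exists (v i).
  have := ltn_ord (v i); rewrite !kE in vi * => vlt.
  by case: (eqVneq k 0%N) => k0; apply/eqP; apply: ord_inj; rewrite kE /=; lia.
apply: leq_trans (_ : \sum_ia #|slice ia| <= _)%N; last first.
  apply: leq_trans (_ : \sum_(ia : 'I_d * bool) (2 * m).+1 ^ d.-1 <= _)%N.
    by apply: leq_sum => ia _; apply: card_slice.
  by rewrite sum_nat_const card_prod card_ord card_bool mulnC [(d * 2)%N]mulnC mulnC.
elim/big_ind2: _ => [|s1 A1 s2 A2 h1 h2|//]; first by rewrite cards0.
by apply: leq_trans (leq_card_setU _ _) _; apply: leq_add.
Qed.

End BoundaryCount.

Section ConnectionBound.
Variables (R : realType) (d : nat) (p : R).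
Variable P : probability (percolation_space d) R.
Hypothesis p01 : 0 <= p <= 1.
Hypothesis Pp : site_percolation p P.
Hypothesis flux : forall n, 2^-1 <= (3 ^ d)%:R * boundary_flux P n.
Implicit Types (x y z b c u v : site d) (A : set (site d)) (m n : nat).

(** Half the average that [critical_flux] gives to the boundary sites, at most
    [2 d (2 n + 1)^(d - 1)] in number. *)
Definition kappa n : R := (4 * (3 ^ d) * (2 * d * (2 * n).+1 ^ d.-1))%:R^-1.

Lemma kappa_ge0 n : 0 <= kappa n.
Proof. by rewrite invr_ge0. Qed.

Lemma kappa_le m n : (0 < d)%N -> (m <= n)%N -> kappa n <= kappa m.
Proof.
move=> d0 mn; have pos k : (0 < 4 * 3 ^ d * (2 * d * (2 * k).+1 ^ d.-1))%N.
  by rewrite !muln_gt0 !expn_gt0 d0.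
rewrite lef_pV2 ?posrE ?ltr0n ?pos // ler_nat !leq_mul2l; apply/orP; right; apply/orP; right.
by case: (d.-1) => // e; rewrite leq_exp2r // ltnS leq_mul2l mn orbT.
Qed.

Hypothesis d_gt0 : (0 < d)%N.

Lemma kappa_gt0 n : 0 < kappa n.
Proof. by rewrite invr_gt0 ltr0n !muln_gt0 !expn_gt0 d_gt0. Qed.

(** Otherwise the flux would be at most half its lower bound. *)
Lemma likely_boundary_site n : exists x i,
  coord_dist x 0 i = n /\ kappa n <= pr P (conn_event (cubeset 0 n) 0 x).
Proof.
suff [x [xb xk]] : exists x, boundary (cubeset 0 n) x /\
    kappa n <= pr P (conn_event (cubeset 0 n) 0 x).
  by have [i xi] := boundary_cube xb; exists x, i.
apply: contrapT => none; have := flux n; rewrite leNgt => /negP; apply.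
set B := (2 * d * (2 * n).+1 ^ d.-1)%N.
have B0 : (0 < B)%N by rewrite !muln_gt0 expn_gt0 d_gt0.
have le : boundary_flux P n <= B%:R * kappa n.
  rewrite /boundary_flux -(sum_boxsite 0 n (fun x => pr P (conn_event (cubeset 0 n) 0 x))
    (fun x => `[< boundary (cubeset 0 n) x >])).
  apply: (@le_trans _ _ (\sum_(v in box_boundary (embed 0 (m:=n)) (cubeset (0 : site d) n))
      kappa n)).
    rewrite [leRHS](eq_bigl (fun f => `[< boundary (cubeset 0 n) (embed 0 f) >])).
      apply: ler_sum => v /asboolP vb; rewrite leNgt; apply/negP => /ltW h.
      by apply: none; exists (embed 0 v).
    by move=> v; rewrite boot.finset.in_set.
  rewrite sumr_const -[leLHS]mulr_natl ler_wpM2r ?kappa_ge0 // ler_nat.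
  exact: card_box_boundary.
have h3 : (0 < 3 ^ d)%N by rewrite expn_gt0.
apply: le_lt_trans (ler_wpM2l _ le) _; first exact: ler0n.
have b0 : (B%:R : R) != 0 by rewrite pnatr_eq0 -lt0n.
have c0 : ((3 ^ d)%:R : R) != 0 by rewrite pnatr_eq0 -lt0n.
rewrite /kappa -/B natrM natrM; set C := (3 ^ d)%:R in c0 *.
have -> : C * (B%:R * (4 * C * B%:R)^-1) = 4^-1 by field; rewrite b0 c0.
lra.
Qed.

Section Region.
Variables (c : site d) (N : nat).
Let A := cubeset c N.
Let K := cube_seq c N.

Let sA x y : supported K (conn_event A x y).
Proof. exact: supported_conn. Qed.

Lemma pr_conn_trans x y z :
  pr P (conn_event A x y) * pr P (conn_event A y z) <= pr P (conn_event A x z).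
Proof.
have sI : supported K (conn_event A x y `&` conn_event A y z).
  by move=> w w' ww [h1 h2]; split; [apply: (sA ww) h1|apply: (sA ww) h2].
have := harris_event p01 Pp (@sA x y) (@sA y z) (@conn_event_increasing _ A x y)
  (@conn_event_increasing _ A y z).
move/le_trans; apply.
by apply: (pr_sub P sI (@sA _ _)) => w [xy yz]; apply: connected_trans yz.
Qed.

Lemma pr_conn_sym x y : pr P (conn_event A x y) <= pr P (conn_event A y x).
Proof. by apply: (pr_sub P (@sA _ _) (@sA _ _)) => w; apply: connected_sym. Qed.

Lemma pr_conn_refl x : A x -> pr P (conn_event A x x) = p.
Proof.
move=> Ax; have [Po _] := Pp; have -> : conn_event A x x = open_at x.
  apply/seteqP; split=> w; first by move=> [[]].
  by move=> wx; apply: connected_refl.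
by rewrite /pr Po.
Qed.

Lemma pr_conn_nbr x y : A x -> A y -> nbr x y -> p ^+ 2 <= pr P (conn_event A x y).
Proof.
move=> Ax Ay xy; rewrite expr2 -{1}(pr_conn_refl Ax) -(pr_conn_refl Ay).
have sI : supported K (conn_event A x x `&` conn_event A y y).
  by move=> w w' ww [h1 h2]; split; [apply: (sA ww) h1|apply: (sA ww) h2].
have := harris_event p01 Pp (@sA x x) (@sA y y) (@conn_event_increasing _ A x x)
  (@conn_event_increasing _ A y y).
move/le_trans; apply.
apply: (pr_sub P sI (@sA _ _)) => w [xx yy].
have Xx := connected_mem xx; have Xy := connected_mem yy.
exact: connected_step xx Xx Xy xy.
Qed.

Definition shift u (j : 'I_d) (k : int) : site d :=
  \row_l (u 0 l + if l == j then k else 0).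

(** A path from [u] to the face of its cube and its mirror image in that face
    form a path from [u] to the reflected centre. *)
Lemma pr_conn_reflect u j (s : int) m : `|s|%N = 1%N ->
  cubeset u m `<=` A -> cubeset (shift u j (s * (2 * m)%:Z)) m `<=` A ->
  kappa m ^+ 2 <= pr P (conn_event A u (shift u j (s * (2 * m)%:Z))).
Proof.
move=> s1; set u' := shift _ _ _ => uA u'A.
have [x [i [xi xk]]] := likely_boundary_site m.
have [t [t1 tx]] : exists t : int, `|t|%N = 1%N /\ t * x 0 i = s * m%:Z.
  rewrite /coord_dist mxE subr0 in xi.
  have : x 0 i = m%:Z \/ x 0 i = - m%:Z by move: (x 0 i) xi => a; lia.
  case=> ->; first by exists s.
  by exists (- s); rewrite abszN mulrNN.
have center v r : swap_flip v i j r 0 = v.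
  by apply/rowP => k; rewrite !mxE mulr0 addr0.
pose y := swap_flip u i j t x.
have yE : y = swap_flip u' i j (- t) x.
  apply/rowP => k; rewrite !mxE; case: eqP => [->|_]; last by rewrite addr0.
  rewrite tpermR mulNr tx.
  have -> : (2 * m)%:Z = m%:Z + m%:Z by lia.
  by ring.
have half v r : `|r|%N = 1%N -> cubeset v m `<=` A ->
    kappa m <= pr P (conn_event A v (swap_flip v i j r x)).
  move=> r1 vA; apply: le_trans xk _.
  apply: le_trans (pr_conn_isometry Pp 0 m x (isometry_swap_flip v i j r1)) _.
  rewrite center; apply: (pr_sub P (@supported_conn _ c N _ _ _ vA) (@sA _ _)) => w.
  by apply: connected_sub => z [zv wz]; split=> //; apply: vA.
rewrite expr2; apply: le_trans (pr_conn_trans u y u').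
apply: ler_pM; rewrite ?kappa_ge0 //; first exact: half.
apply: le_trans (pr_conn_sym u' y).
by rewrite yE; apply: half => //; rewrite abszN.
Qed.

End Region.

(** A reflection covers any even displacement; an odd one takes a further step. *)
Lemma pr_conn_coordinate n u (j : 'I_d) (k : int) : cube 0 n u ->
  cube 0 n (shift u j k) ->
  kappa n ^+ 2 * p ^+ 2 <= pr P (conn_event (cubeset 0 (2 * n)) u (shift u j k)).
Proof.
move=> un u'n; have [p0 p1] := andP p01.
pose m := (`|k|%N)./2; pose r := odd `|k|%N.
have [s [s1 sk]] : exists s : int, `|s|%N = 1%N /\ k = s * (`|k|%N)%:Z.
  by case: k {un u'n m r} => k; [exists 1; rewrite mul1r|exists (-1); rewrite mulN1r].
have km : (`|k|%N = r + 2 * m)%N by rewrite /m /r mul2n odd_double_half.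
have uj : (coord_dist u 0%R j <= n)%N by apply/cubeP.
have u'j : (`|(u 0 j + k)%R| <= n)%N.
  by move/cubeP/(_ j): u'n; rewrite /coord_dist !mxE eqxx subr0.
rewrite /coord_dist mxE subr0 in uj.
have mn : (m <= n)%N by lia.
set v := shift u j (s * (2 * m)%:Z).
have vn : cube 0 n v.
  apply/cubeP => l; have /cubeP/(_ l) := un; rewrite /coord_dist !mxE !subr0.
  case: eqP => [->|_]; last by rewrite addr0.
  have : s = 1 \/ s = -1 by lia.
  by case=> sE; move: sk; rewrite sE; lia.
have sub z : cube 0 n z -> cubeset z m `<=` cubeset 0 (2 * n).
  move=> /cubeP zn; apply: (@cubeset_sub _ 0 z) => l.
  by rewrite mul2n -addnn leq_add.
have c1 := pr_conn_reflect s1 (sub _ un) (sub _ vn).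
rewrite -/v in c1.
have c1' : kappa n ^+ 2 <= pr P (conn_event (cubeset 0 (2 * n)) u v).
  apply: le_trans c1; rewrite lerXn2r ?nnegrE ?kappa_ge0 //.
  exact: kappa_le.
have sub0 z : cube 0 n z -> cubeset 0 (2 * n) z.
  apply: (@cube_sub _ 0 0) => l.
  by rewrite /coord_dist subrr add0n mul2n -addnn leq_addr.
have [rE|rE] := boolP r; last first.
  have -> : shift u j k = v.
    apply/rowP => l; rewrite !mxE; congr (_ + _); case: ifP => // _.
    by rewrite sk km (negPf rE) add0n.
  apply: le_trans c1'; rewrite ler_piMr ?sqr_ge0 // exprn_ile1 //.
apply: le_trans (pr_conn_trans _ _ u v _); apply: ler_pM c1' _; rewrite ?sqr_ge0 //.
apply: pr_conn_nbr; [exact: sub0|exact: sub0|].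
rewrite /nbr (bigD1 j) //= big1 => [|l lj]; rewrite /coord_dist !mxE.
  rewrite eqxx addn0; apply/eqP; have : s = 1 \/ s = -1 by lia.
  by move: sk; rewrite km rE => sk; case=> sE; rewrite sE in sk *; lia.
by rewrite (negPf lj) subrr.
Qed.

Definition mix u v (k : nat) : site d := \row_l (if (l < k)%N then v 0 l else u 0 l).

(** Moving the coordinates one at a time costs [kappa n ^ (2 d)], that is,
    [n ^ (- 2 d (d - 1))] up to a constant. *)
Lemma pr_conn_lower_bound n u v : cube 0 n u -> cube 0 n v ->
  p * (kappa n ^+ 2 * p ^+ 2) ^+ d <=
  pr P (conn_event (cubeset 0 (2 * n)) u v).
Proof.
move=> un vn; have [p0 p1] := andP p01.
have mixn k : cube 0 n (mix u v k).
  apply/cubeP => l; move/cubeP/(_ l): un; move/cubeP/(_ l): vn.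
  by rewrite /coord_dist !mxE; case: ifP.
suff key k : (k <= d)%N -> p * (kappa n ^+ 2 * p ^+ 2) ^+ k <=
    pr P (conn_event (cubeset 0 (2 * n)) u (mix u v k)).
  have vE : mix u v d = v by apply/rowP => l; rewrite !mxE ltn_ord.
  by have := key d (leqnn d); rewrite vE.
elim: k => [|k IH] kd.
  have -> : mix u v 0 = u by apply/rowP => l; rewrite !mxE.
  rewrite expr0 mulr1 pr_conn_refl //.
  apply: (@cube_sub _ 0 0 (2 * n) n) un => l.
  by rewrite /coord_dist subrr add0n mul2n -addnn leq_addr.
pose j := Ordinal kd; pose a := v 0 j - u 0 j.
have mixS : mix u v k.+1 = shift (mix u v k) j a.
  apply/rowP => l; rewrite !mxE ltnS leq_eqVlt -[l == j]/(l == k :> nat).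
  case: eqP => [lk|_]; last by rewrite addr0.
  by rewrite lk ltnn (_ : l = j) ?subrKC //; apply: val_inj.
apply: le_trans (pr_conn_trans _ _ _ (mix u v k) _).
rewrite exprSr mulrA; apply: ler_pM.
- by apply: mulr_ge0 => //; apply: exprn_ge0; apply: mulr_ge0; apply: sqr_ge0.
- by apply: mulr_ge0; apply: sqr_ge0.
- by apply: IH; apply: ltnW.
by rewrite mixS; apply: pr_conn_coordinate; rewrite -?mixS.
Qed.

End ConnectionBound.

(** * The two estimates on boxes *)

Section TwoArmEstimates.
Variables (R : realType) (d : nat) (p : R).
Variable P : probability (percolation_space d) R.
Hypothesis p01 : 0 <= p <= 1.
Hypothesis Pp : site_percolation p P.
Implicit Types (x y z b c u v : site d) (m n M N : nat).

Lemma subcube_seq (c c' : site d) m m' : cubeset c' m' `<=` cubeset c m ->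
  #|subcube c m c' m'| = ((2 * m').+1 ^ d)%N.
Proof.
move=> sub; rewrite -(size_cube_seq c' m').
rewrite -(size_image (embed c (m:=m)) (subcube c m c' m')).
apply/perm_size/uniq_perm; last 1 first.
- move=> x; rewrite mem_cube_seq; apply/fintype.imageP/idP => [[f]|xc'].
    by rewrite boot.finset.in_set => fc' ->.
  have /cube_embed[f fx] := sub x xc'.
  by exists f; rewrite ?boot.finset.in_set fx.
- by rewrite map_inj_uniq ?enum_uniq //; apply: embed_inj.
- exact: uniq_cube_seq.
Qed.

Definition two_arm_prob m : R := pr P (arms_event (cubeset 0 m) 0).

Lemma pr_arms_le c m b m' : cubeset b m' `<=` cubeset c m -> (0 < m')%N ->
  pr P (arms_event (cubeset c m) b) <= two_arm_prob m'.
Proof.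
move=> sub m'0; rewrite /two_arm_prob (pr_arms_translation Pp 0 b).
have s1 := @supported_arms _ c m (cubeset c m) b (@subset_refl _ _).
have s2 := @supported_arms _ b m' (cubeset b m') b (@subset_refl _ _).
apply: (pr_sub P s1 s2) => w; apply: arms_sub => // x /nbr_cube1.
by apply: cube_sub => i; rewrite /coord_dist subrr add0n.
Qed.

(** Two arms from [b] to distance [2 M + 2] cross the cube of half-side [M + 1]
    around the origin whenever [b] lies in the concentric one of half-side [M]. *)
Lemma sum_prob_two_arms_ge M :
  ((2 * M).+1 ^ d)%:R * two_arm_prob (2 * M.+1) <=
  \sum_(b : boxsite d M.+1) prob p (fun w =>
    two_arms_at (nbr_via (embed 0 (m:=M.+1)))
      (box_boundary (embed 0 (m:=M.+1)) (cubeset (0 : site d) M.+1)) w b).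
Proof.
have subM : cubeset (0 : site d) M `<=` cubeset 0 M.+1.
  by apply: (@cubeset_sub _ 0 0) => i; rewrite /coord_dist subrr.
rewrite -(subcube_seq subM) mulr_natl -sumr_const.
rewrite [leRHS](bigID (fun f => f \in subcube 0 M.+1 0 M)) /=.
rewrite -[leLHS]addr0; apply: lerD; last by rewrite sumr_ge0 // => f _; apply: prob_ge0.
apply: ler_sum => f; rewrite boot.finset.in_set => /cubeP fM.
rewrite (prob_two_arms Pp) //; last first.
  move=> x /nbr_cube1/cubeP fx; apply/cubeP => i.
  by have := fM i; have := fx i; rewrite /coord_dist; lia.
rewrite /two_arm_prob (pr_arms_translation Pp 0 (embed 0 f)).
have s1 := @supported_arms _ 0 M.+1 _ (embed 0 f) (@subset_refl _ (cubeset 0 M.+1)).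
have s2 := @supported_arms _ _ _ _ (embed 0 f)
  (@subset_refl _ (cubeset (embed 0 f) (2 * M.+1))).
apply: (pr_sub P s2 s1) => w; apply: arms_sub => x.
  move=> /cubeP xM; apply/cubeP => i; have := xM i; have := fM i.
  by rewrite /coord_dist; lia.
move=> /nbr_cube1/cubeP fx; apply/cubeP => i.
by have := fM i; have := fx i; rewrite /coord_dist; lia.
Qed.

(** The two-arm exponent is at least one half: [sum_prob_two_arms_at] has the
    order [N^(d - 1/2) log N], and all the sites contribute equally by
    translation invariance. *)
Lemma two_arm_decay : (0 < d)%N -> 0 < p -> p < 1 -> exists C, 0 <= C /\ forall M,
  two_arm_prob (2 * M.+1) <=
  C * ((1 + ln (2 * M.+1).+1%:R) / Num.sqrt (2 * M.+1).+1%:R).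
Proof.
move=> d_gt0 p0 p1.
pose C1 : R := (2 * d + (2 + 3 ^ d) + 2 * d * d + 2)%:R.
pose C : R := 2 * C1 * (3 ^ d)%:R / (p * (1 - p)).
have pq0 : 0 < p * (1 - p) by apply: mulr_gt0 => //; rewrite subr_gt0.
have C0 : 0 <= C.
  by apply: divr_ge0; [rewrite !mulr_ge0 ?ler0n|exact: ltW].
exists C; split=> // M; set N := (2 * M.+1).+1.
have N1 : (1 : R) <= N%:R by rewrite ler1n.
have N0 : (0 : R) < N%:R by apply: lt_le_trans N1.
set s : R := Num.sqrt N%:R.
have s1 : 1 <= s by rewrite -[1]sqrtr1 ler_wsqrtr.
have s0 : 0 < s by apply: lt_le_trans s1.
have sE : s ^+ 2 = N%:R by rewrite sqr_sqrtr // ltW.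
have lnN : 0 <= ln N%:R :> R by rewrite ln_ge0.
pose f := embed (0 : site d) (m:=M.+1).
pose S := box_boundary f (cubeset (0 : site d) M.+1).
pose T : R := \sum_b prob p (fun w => two_arms_at (nbr_via f) S w b).
pose K : R := (N ^ d.-1)%:R.
have K1 : 1 <= K by rewrite /K ler1n expn_gt0.
have Kd : (N ^ d)%:R = N%:R * K :> R by rewrite /K -natrM -expnS prednK.
have deg g : (#|[set h | nbr_via f g h]%SET| <= 3 ^ d)%N by apply: card_nbr_box.
have SK : #|S|%:R <= (2 * d)%:R * K.
  by rewrite /K -natrM ler_nat; apply: card_box_boundary.
have SN : #|S|%:R <= (N ^ d)%:R :> R by rewrite ler_nat -card_boxsite max_card.
(* balances [l ^ 2 |V|], with [|V| = N ^ d], against [|S|] *)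
pose l : R := (2 * s)^-1.
have l2 : 0 <= l <= 2^-1.
  have s20 : 0 < 2 * s by apply: mulr_gt0.
  apply/andP; split; first by rewrite /l invr_ge0 ltW.
  by rewrite /l lef_pV2 ?posrE // ler_peMr.
(* so that [expR (- L) * |S| <= 1] *)
pose L : R := d%:R * ln N%:R.
have L0 : 0 <= L by rewrite mulr_ge0.
have eL : expR (- L) * #|S|%:R <= 1.
  rewrite expRN expRM_natl lnK ?posrE // mulrC ler_pdivrMr ?exprn_gt0 // mul1r.
  by rewrite -natrX.
have akn := sum_prob_two_arms_at (nbr_via_sym f) S deg p01 l2 L0.
rewrite -/T card_boxsite -/N in akn.
have l2E : 2 * l ^+ 2 * ((2 + 3 ^ d) * N ^ d)%:R = (2 + 3 ^ d)%:R / 2 * K.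
  rewrite natrM Kd /l exprVn exprMn sE; field.
  by rewrite lt0r_neq0.
have rhs : l * p * (1 - p) * T <= C1 * K * (1 + ln N%:R).
  apply: le_trans akn _; rewrite l2E.
  have e1 : l * #|S|%:R <= (2 * d)%:R * K.
    by apply: le_trans SK; rewrite ler_piMl //; lra.
  have e2 : #|S|%:R * L <= (2 * d * d)%:R * K * ln N%:R.
    rewrite /L mulrA ler_wpM2r // natrM -mulrA [X in _ <= X]mulrCA [leRHS]mulrC.
    rewrite ler_wpM2r //.
  have e3 : (2 + 3 ^ d)%:R / 2 * K <= (2 + 3 ^ d)%:R * K.
    by rewrite ler_wpM2r // ?(le_trans _ K1) // ler_pdivrMr // ler_peMr //; lra.
  rewrite /C1 !natrD in e3 *.
  have h1 : 0 <= K * ln N%:R by rewrite mulr_ge0 // (le_trans _ K1).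
  have h2 : 0 <= (2 * d)%:R * (K * ln N%:R) by rewrite mulr_ge0.
  have h3 : 0 <= (3 ^ d)%:R * (K * ln N%:R) by rewrite mulr_ge0.
  have h4 : 0 <= (2 * d * d)%:R * K by rewrite mulr_ge0 // (le_trans _ K1).
  nra.
have lower : ((2 * M).+1 ^ d)%:R * two_arm_prob (2 * M.+1) <= T.
  exact: sum_prob_two_arms_ge.
have N3 : (N ^ d)%:R <= (3 ^ d)%:R * ((2 * M).+1 ^ d)%:R :> R.
  have le3 : (N <= 3 * (2 * M).+1)%N by clear; rewrite /N; lia.
  by rewrite -natrM ler_nat -expnMn leq_exp2r.
rewrite mulrA ler_pdivlMr //.
have T0 : 0 <= two_arm_prob (2 * M.+1) by apply: pr_ge0.
have TT : N%:R * K * two_arm_prob (2 * M.+1) <= (3 ^ d)%:R * T.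
  rewrite -Kd; apply: le_trans (ler_wpM2r T0 N3) _.
  by rewrite -mulrA ler_wpM2l.
have TC : T <= 2 * s / (p * (1 - p)) * (C1 * K * (1 + ln N%:R)).
  rewrite mulrAC ler_pdivlMr // -ler_pdivrMl ?mulr_gt0 //.
  by rewrite -/l; apply: le_trans rhs; rewrite le_eqVlt; apply/orP; left; apply/eqP; ring.
have K0 : 0 < K by apply: lt_le_trans K1.
rewrite -(ler_pM2l K0) -(ler_pM2l s0).
have -> : s * (K * (two_arm_prob (2 * M.+1) * s)) = N%:R * K * two_arm_prob (2 * M.+1).
  by rewrite -sE; ring.
apply: le_trans TT _; apply: le_trans (ler_wpM2l _ TC) _ => //.
by rewrite le_eqVlt; apply/orP; left; apply/eqP; rewrite /C; field; lra.
Qed.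

(** ** Clusters crossing an annulus *)

Definition crossing_event n N : set (configuration d) :=
  finite_event (embed (0 : site d) (m:=N))
    (two_crossing (nbr_via (embed 0 (m:=N))) (subcube 0 N 0 n)
       (box_boundary (embed 0 (m:=N)) (cubeset (0 : site d) N))).

(** Around each site of the inner cube [2 n] the outer cube contains a cube of
    half-side [2 M + 2], to which [two_arm_prob] applies. *)
Lemma pr_crossing_event n N M (c : R) : 0 <= c -> (2 * n + 2 * M.+1 <= N)%N ->
  (forall u v, cube 0 n u -> cube 0 n v ->
     c <= pr P (conn_event (cubeset 0 (2 * n)) u v)) ->
  p * c * pr P (crossing_event n N) <=
  ((3 ^ d) ^ 2 * ((4 * n).+1 ^ d) ^ 2)%:R * two_arm_prob (2 * M.+1).
Proof.
move=> c0 nMN hc; rewrite /crossing_event (pr_finite_event Pp _ (@embed_inj _ _ _)).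
pose f := embed (0 : site d) (m:=N); pose D := subcube (0 : site d) N 0 (2 * n).
have subD : cubeset (0 : site d) (2 * n) `<=` cubeset 0 N.
  by apply: (@cubeset_sub _ 0 0) => i; rewrite /coord_dist subrr add0n; lia.
have deg g : (#|[set h | nbr_via f g h]%SET| <= 3 ^ d)%N by apply: card_nbr_box.
have conn (u v : boxsite d N) : u \in subcube 0 N 0 n -> v \in subcube 0 N 0 n ->
    c <= prob p (fun w => v \in cluster (nbr_via f) (w :&: D) u).
  rewrite !boot.finset.in_set => un vn.
  by rewrite (prob_connected Pp u v (image_subcube subD)); apply: hc.
apply: le_trans (gluing (nbr_via_sym f) _ deg p01 c0 conn) _.
have cardD : #|D| = ((4 * n).+1 ^ d)%N by rewrite (subcube_seq subD) mulnA.
have -> : ((3 ^ d) ^ 2 * ((4 * n).+1 ^ d) ^ 2)%:R * two_arm_prob (2 * M.+1) =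
    ((3 ^ d) ^ 2 * #|D|)%:R * \sum_(b in D) two_arm_prob (2 * M.+1).
  by rewrite sumr_const cardD -[two_arm_prob _ *+ _]mulr_natl mulrA -natrM -mulnA mulnn.
rewrite ler_wpM2l //; apply: ler_sum => b; rewrite boot.finset.in_set => /cubeP bD.
rewrite (prob_two_arms Pp); last first.
  move=> x /nbr_cube1/cubeP bx; apply/cubeP => i.
  by have := bD i; have := bx i; rewrite /coord_dist; lia.
apply: pr_arms_le => // x /cubeP xb; apply/cubeP => i.
by have := bD i; have := xb i; rewrite /coord_dist; lia.
Qed.

End TwoArmEstimates.

(** * Two arms in a large annulus *)

Section TwoArmsEvent.
Variables (R : realType) (d : nat).
Implicit Types (x y z : site d) (w : configuration d) (r l : R) (n N : nat).

Lemma boxE r : 0 <= r -> @box R d r = cubeset 0 (Num.truncn r).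
Proof.
move=> r0; have norm x i : (coord_dist x 0%R i)%:R = `|(x 0 i)%:~R| :> R.
  by rewrite /coord_dist mxE subr0 -[LHS]/((Posz `|(x 0 i)%R|%N)%:~R) abszE intr_norm.
apply/seteqP; split=> x.
  move=> xr; apply/cubeP => i; rewrite truncn_ge_nat // norm ler_norml.
  exact: xr.
by move=> /cubeP xr i; have := xr i; rewrite truncn_ge_nat // norm ler_norml.
Qed.

Lemma inner_boundaryE (A : set (site d)) : inner_boundary R A = boundary A.
Proof.
apply/seteqP; split=> x [Ax [y [Ay xy]]]; split=> //; exists y; split=> //.
  exact/(neighborsE R).
exact/(neighborsE R).
Qed.

Lemma two_arms_crossing n l w : 0 <= l -> @two_arms R d n l w ->
  crossing_event n (Num.truncn (n%:R + l)) w.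
Proof.
move=> l0 [C1 [C2 [C12 [c1 b1 s1] [c2 b2 s2]]]].
have nl0 : 0 <= n%:R + l by rewrite addr_ge0.
set N := Num.truncn _; pose A := cubeset (0 : site d) N.
pose f := embed (0 : site d) (m:=N).
have AE : box (n%:R + l) = A by rewrite boxE.
rewrite AE in c1 c2 s1 s2.
have nA : @box R d n%:R = cubeset 0 n by rewrite boxE // natrK.
have cross C : open_cluster R A w C -> C `&` @box R d n%:R !=set0 ->
    C `&` inner_boundary R A !=set0 ->
    exists u, [/\ u \in subcube 0 N 0 n, C = [set y | connected_in (A `&` opened w) (f u) y] &
      meets (cluster (nbr_via f) (pull f w) u) (box_boundary f A)].
  move=> [x [Ax wx] CE] [y [Cy yn]] [s [Cs sA]].
  rewrite nA in yn; rewrite inner_boundaryE in sA.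
  have CE' : C = [set y | connected_in (A `&` opened w) x y].
    rewrite CE adjacent_inE /open_sites; apply/seteqP; split=> z //=; last by case.
  rewrite {Cy}CE' /= in Cy Cs *.
  have [u uy] : exists u, f u = y.
    by apply: cube_embed; have := connected_mem Cy; case.
  exists u; split.
  - by rewrite boot.finset.in_set -/(f u) uy.
  - rewrite uy; apply/seteqP; split=> z /= h; last exact: connected_trans h.
    exact: connected_trans (connected_sym Cy) h.
  apply/(pull_meets (@embed_inj _ _ _) (range_embed 0 N)).
  rewrite -/(f u) uy; exists s; split=> //.
  exact: connected_trans (connected_sym Cy) Cs.
have [u [un C1E mu]] := cross _ c1 b1 s1.
have [v [vn C2E mv]] := cross _ c2 b2 s2.
apply/existsP; exists u; rewrite un /=; apply/existsP; exists v.
rewrite vn mu mv !andbT /=; apply: contra_notN C12 => /eqP uv.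
have uv' : connected_in (A `&` opened w) (f v) (f u).
  apply/(pull_connected (@embed_inj _ _ _) (range_embed 0 N)).
  rewrite -/f -uv cluster_refl.
  by case/existsP: mu => s /andP[_ /cluster_src].
rewrite C1E C2E; apply/seteqP; split=> z /= h; first exact: connected_trans h.
exact: connected_trans (connected_sym uv') h.
Qed.

Lemma supported_two_arms n l : 0 <= l ->
  supported (cube_seq 0 (Num.truncn (n%:R + l))) (@two_arms R d n l).
Proof.
move=> l0; have nl0 : 0 <= n%:R + l by rewrite addr_ge0.
move=> w w' ww; suff E : open_cluster R (box (n%:R + l)) w =
    open_cluster R (box (n%:R + l)) w'.
  by rewrite /two_arms /crossing_cluster /= E.
apply/funext => C; rewrite /open_cluster.
suff -> : open_sites (@box R d (n%:R + l)) w = open_sites (box (n%:R + l)) w' by [].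
rewrite boxE //; apply/seteqP; split=> x [xA wx]; split=> //; move: wx => /=;
  by rewrite ww // mem_cube_seq.
Qed.

Lemma supported_crossing n N : supported (cube_seq (0 : site d) N) (crossing_event n N).
Proof.
move=> w w' ww; rewrite /crossing_event /finite_event /=.
suff -> : pull (embed (0 : site d) (m:=N)) w = pull (embed 0 (m:=N)) w' by [].
by apply/setP => u; rewrite !boot.finset.in_set ww // codom_f.
Qed.

(** Each step brings one coordinate closer to zero. *)
Lemma cube_connected N x : cubeset 0 N x -> connected_in (cubeset 0 N) x 0.
Proof.
have [k] := ubnP (\sum_i coord_dist x (0%R : site d) i)%N.
elim: k x => // k IH x xk xN.
have [/eqP|x0] := eqVneq x 0; first by move=> /eqP->; apply/connected_refl/cube_center.
have [i xi] : exists i, x 0 i != 0.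
  by apply/existsP; rewrite -negb_forall; apply: contra x0 => /forallP h;
    apply/eqP/rowP => i; rewrite mxE; apply/eqP.
pose y := shift x i (if (0 < x 0 i) then -1 else 1).
have yi : (coord_dist x 0%R i = (coord_dist y 0%R i).+1)%N.
  rewrite /coord_dist !mxE eqxx; move: (x 0 i) xi => a; case: ifP; lia.
have yj j : j != i -> coord_dist y 0%R j = coord_dist x 0%R j.
  by move=> ji; rewrite /coord_dist !mxE (negPf ji) addr0.
have yN : cubeset 0 N y.
  apply/cubeP => j; have /cubeP/(_ j) := xN.
  by case: (eqVneq j i) => [->|/yj ->//]; rewrite yi; apply: ltnW.
have xy : nbr x y.
  rewrite /nbr (bigD1 i) //= big1 => [|j ji]; rewrite /coord_dist !mxE.
    by rewrite eqxx addn0; case: ifP => _; apply/eqP; lia.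
  by rewrite (negPf ji) addr0 subrr.
apply: connected_trans (IH y _ yN).
  by apply: connected_step (connected_refl xN) xN yN xy.
move: xk; rewrite (bigD1 i) //= yi addSn ltnS; apply: leq_trans.
rewrite ltnS [X in (X <= _)%N](bigD1 i) //= leq_add2l; apply: leq_sum => j ji.
by rewrite yj.
Qed.

End TwoArmsEvent.

Section Asymptotics.
Variable R : realType.
Implicit Types (x d a : R) (n : nat).

Lemma ln_le_powR x d : 1 <= x -> 0 < d -> 1 + ln x <= (1 + d^-1) * x `^ d.
Proof.
move=> x1 d0; have x0 : 0 < x by apply: lt_le_trans x1.
have xd1 : 1 <= x `^ d by rewrite -(powRr0 x) ler_powR // ltW.
rewrite mulrDl mul1r; apply: lerD => //.
rewrite mulrC ler_pdivlMr // mulrC -ln_powR.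
have := @le_ln1Dx R (x `^ d - 1); rewrite subrKC => h.
apply: le_trans (h _) _; last by rewrite gerBl.
by rewrite ltrBrDl subrr powR_gt0.
Qed.

Lemma ln_div_sqrt_le x d : 1 <= x -> 0 < d ->
  (1 + ln x) / Num.sqrt x <= (1 + d^-1) * x `^ (d - 2^-1).
Proof.
move=> x1 d0; have x0 : 0 < x by apply: lt_le_trans x1.
rewrite ler_pdivrMr ?sqrtr_gt0 // -(powR12_sqrt (ltW x0)) -mulrA -powRD; last first.
  by rewrite (gt_eqF x0) implybT.
by rewrite subrK; apply: ln_le_powR.
Qed.

Lemma powR_cvg_infty (K g : R) : 0 <= K -> 0 < g ->
  (K * n%:R `^ (- g)) @[n --> \oo] --> (0 : R).
Proof.
move=> K0 g0; apply/cvgr0Pnorm_lt => e e0.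
near=> n; have n0 : (0 : R) < n%:R by near: n; apply: nbhs_infty_gtr.
rewrite ger0_norm ?mulr_ge0 ?powR_ge0 // powRN.
rewrite ltr_pdivrMr ?powR_gt0 //.
have : ((K + 1) / e) `^ g^-1 <= n%:R by near: n; apply: nbhs_infty_ger.
move=> h; have Ke0 : 0 < (K + 1) / e by rewrite divr_gt0 // ltr_pwDr.
have := ge0_ler_powR (ltW g0) (powR_ge0 _ _) (ltW n0) h.
rewrite -powRrM mulVf ?gt_eqF // (powRr1 (ltW Ke0)) ler_pdivrMr // => h'.
rewrite mulrC; apply: lt_le_trans h'; rewrite ltrDl //.
Unshelve. all: by end_near.
Qed.

End Asymptotics.

Section Degenerate.
Variables (R : realType) (d : nat).
Variable P : probability (percolation_space d) R.

Lemma prob_eq0 (V : finType) (p : R) (A D : {set V}) (Q : pred {set V}) :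
  0 <= p <= 1 -> [disjoint A & D]%B -> p ^+ #|A| * (1 - p) ^+ #|D| = 1 ->
  (forall w, cylinder A D w -> ~~ Q w) -> prob p Q = 0.
Proof.
move=> p01 AD cyl1 nQ; apply/eqP; rewrite eq_le prob_ge0 // andbT.
have cE : prob p (cylinder A D) = 1 by rewrite prob_cylinder.
suff : prob p Q + prob p (cylinder A D) <= 1 by rewrite cE; lra.
rewrite -[leRHS](expect1 V p) -expectD; apply: ler_expect => // w.
rewrite -natrD (ler_nat _ _ 1).
by case: (boolP (cylinder A D w)) => [/nQ/negPf ->|_]; case: (Q w).
Qed.

(** With all sites closed there is no cluster, with all sites open only one. *)
Lemma pr_crossing_degenerate p n N : site_percolation p P -> p = 0 \/ p = 1 ->
  pr P (crossing_event n N) = 0.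
Proof.
move=> Pp pE; have p01 : 0 <= p <= 1 by case: pE => ->; rewrite lexx ler01.
rewrite (pr_finite_event Pp _ (@embed_inj _ _ _)).
case: pE => pE.
  apply: (@prob_eq0 _ _ boot.finset.set0 [set: boxsite d N]%SET) => //.
  - by rewrite -boot.finset.setI_eq0 boot.finset.set0I.
  - by rewrite pE subr0 expr1n mulr1 cards0.
  move=> w /andP[_ /pred0P w0]; apply/negP.
  case/existsP => u /andP[_ /existsP[v /and4P[_ _ /existsP[s /andP[_ /cluster_src uw]] _]]].
  by have := w0 u; rewrite /= uw boot.finset.in_setT.
apply: (@prob_eq0 _ _ [set: boxsite d N]%SET boot.finset.set0) => //.
- by rewrite -boot.finset.setI_eq0 boot.finset.setI0.
- by rewrite pE expr1n mul1r cards0.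
move=> w /andP[/fintype.subsetP wT _]; apply/negP.
case/existsP => u /andP[_ /existsP[v /and4P[_ uv _ _]]]; case/eqP: uv.
have wE : w = pull (embed (0 : site d) (m:=N)) (fun=> true).
  by apply/setP => z; rewrite boot.finset.in_set wT.
apply/esym/(cluster_eq (nbr_via_sym _)); rewrite wE.
apply/(pull_connected (@embed_inj _ _ _) (range_embed 0 N)).
have sub : cubeset (0 : site d) N `<=` cubeset 0 N `&` opened (fun=> true) by [].
have toO f : connected_in (cubeset 0 N `&` opened (fun=> true)) (embed (0 : site d) (m:=N) f) 0.
  by apply: connected_sub sub _; apply: cube_connected; apply: embed_cube.
exact: connected_trans (toO u) (connected_sym (toO v)).
Qed.

End Degenerate.

Section CrossingBound.
Variables (R : realType) (d : nat) (p : R).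
Variable P : probability (percolation_space d) R.
Hypotheses (p0 : 0 < p) (p1 : p < 1).
Hypothesis Pp : site_percolation p P.
Hypothesis flux : forall n, 2^-1 <= (3 ^ d)%:R * boundary_flux P n.
Hypothesis d_gt0 : (0 < d)%N.

Lemma inv_kappa_le n : (0 < n)%N ->
  (kappa R d n)^-1 <= (4 * 3 ^ d * (2 * d * 3 ^ d.-1))%:R * n%:R ^+ d.-1.
Proof.
move=> n0; rewrite invrK -natrX -natrM ler_nat -!mulnA !leq_mul2l.
do 4!(apply/orP; right); rewrite -expnMn; case: d.-1 => // e.
rewrite leq_exp2r //; lia.
Qed.

(** The connection costs [n ^ (2 d (d - 1))], and the positions of the opened site
    and of the two-arm site cost [n ^ d] each. *)
Lemma crossing_le_two_arm : exists K : R, 0 <= K /\ forall n N M : nat,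
  (0 < n)%N -> (2 * n + 2 * M.+1 <= N)%N ->
  pr P (crossing_event n N) <=
  K * n%:R ^+ (2 * d ^ 2) * two_arm_prob P (2 * M.+1).
Proof.
have p01 : 0 <= p <= 1 by rewrite !ltW.
pose C1 : R := (4 * 3 ^ d * (2 * d * 3 ^ d.-1))%:R.
pose K : R := p ^- (2 * d + 2) * C1 ^+ (2 * d) * (((3 ^ d) ^ 2)%:R * 5%:R ^+ (2 * d)).
exists K; split.
  by rewrite !mulr_ge0 ?invr_ge0 ?exprn_ge0 // ltW.
move=> n N M n0 nMN.
set T := two_arm_prob P _; have T0 : 0 <= T by apply: pr_ge0.
pose k := kappa R d n; have k0 : 0 < k by apply: kappa_gt0.
pose c := p * (k ^+ 2 * p ^+ 2) ^+ d.
have c0 : 0 < c by rewrite mulr_gt0 ?exprn_gt0 ?mulr_gt0 ?exprn_gt0.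
have conn u v : cube 0 n u -> cube 0 n v ->
    c <= pr P (conn_event (cubeset 0 (2 * n)) u v).
  exact: pr_conn_lower_bound.
have := pr_crossing_event p01 Pp (ltW c0) nMN conn; rewrite -/T -ler_pdivlMl; last first.
  exact: mulr_gt0.
move/le_trans; apply.
have n5 : (((4 * n).+1 ^ d) ^ 2)%:R <= 5%:R ^+ (2 * d) * n%:R ^+ (2 * d) :> R.
  rewrite -exprMn -natrM -natrX ler_nat -expnM [(2 * d)%N]mulnC leq_exp2r ?muln_gt0 ?d_gt0 //.
  by lia.
have pcE : p * c = p ^+ (2 * d + 2) * k ^+ (2 * d).
  by rewrite /c exprMn -!exprM exprD expr2; ring.
have kk : (k ^+ (2 * d))^-1 <= C1 ^+ (2 * d) * n%:R ^+ (d.-1 * (2 * d)).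
  rewrite -exprVn (exprM n%:R d.-1) -exprMn lerXn2r ?nnegrE ?invr_ge0 ?(ltW k0) //.
    by rewrite mulr_ge0 ?exprn_ge0.
  exact: inv_kappa_le.
have expE : (2 * d ^ 2 = d.-1 * (2 * d) + 2 * d)%N.
  by rewrite -mulSnr prednK // -mulnn mulnCA.
rewrite pcE invfM /K; set A := p ^- _; rewrite expE exprD natrM;
set G := ((3 ^ d) ^ 2)%:R; set F := 5%:R ^+ _ in n5 *.
set H := (_ ^ 2)%:R in n5 *; set X := n%:R ^+ (2 * d) in n5 *.
set Y := n%:R ^+ _ in kk *; set Z := (k ^+ _)^-1 in kk *; set W := C1 ^+ _ in kk *.
have A0 : 0 <= A by rewrite invr_ge0 exprn_ge0 // ltW.
have Z0 : 0 <= Z by rewrite invr_ge0 exprn_ge0 // ltW.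
have -> : A * W * (G * F) * (Y * X) * T = A * (W * Y) * (G * (F * X) * T) by ring.
apply: ler_pM; rewrite ?mulr_ge0 //; first by rewrite ler_wpM2l.
by rewrite ler_wpM2r // ler_wpM2l.
Qed.

End CrossingBound.

(** [4 d ^ 2] is where the gluing cost [n ^ (2 d ^ 2)] meets the decay
    [(n ^ alpha) ^ (- 1/2)]. *)
Lemma exponent_gt (R : realType) (d : nat) (alpha : R) : (2 <= d)%N ->
  (2 * d%:R ^+ 2 + 2 * d%:R - 2) / (2 * d%:R ^+ 2 + 3 * d%:R - 3)
    * (4 * d%:R ^+ 2 + 5 * d%:R - 5) < alpha ->
  4 * d%:R ^+ 2 < alpha.
Proof.
move=> d2; apply: le_lt_trans; have : (2 : R) <= d%:R by rewrite ler_nat.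
move: (d%:R : R) => D D2.
rewrite mulrAC ler_pdivlMr; last by nra.
nra.
Qed.

(** The height of the annulus, rounded to a box of even size. *)
Lemma annulus_size (R : realType) (alpha : R) (n : nat) : 2 <= alpha -> (4 <= n)%N ->
  let N := Num.truncn (n%:R + n%:R `^ alpha) in
  exists M, (2 * n + 2 * M.+1 <= N)%N /\
    n%:R `^ alpha / 4 <= (2 * M.+1).+1%:R.
Proof.
move=> a2 n4 N; set l := n%:R `^ alpha in N *.
have x4 : (4 : R) <= n%:R by rewrite ler_nat.
have l2 : n%:R ^+ 2 <= l.
  by rewrite -powR_mulrn // /l ler_powR //; lra.
have NS : n%:R + l < N.+1%:R by apply: truncnS_gt.
have N5 : (5 * n < N.+1)%N by rewrite -(ltr_nat R) natrM; nra.
exists ((N - 2 * n)./2.-1).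
have h2 : ((N - 2 * n)./2.-1.+1 = (N - 2 * n)./2)%N.
  by rewrite prednK // half_gt0; lia.
have hodd := odd_double_half (N - 2 * n).
have le1 : (N <= (2 * (N - 2 * n)./2).+1 + 2 * n)%N.
  by move: hodd; case: (odd _); lia.
rewrite h2; split; first by move: hodd; lia.
have : N%:R <= (2 * (N - 2 * n)./2).+1%:R + 2 * n%:R :> R.
  by rewrite -natrM -natrD ler_nat.
rewrite -natr1 in NS; nra.
Qed.

Section MainEstimate.
Variables (R : realType) (d : nat) (p alpha : R).
Variable P : probability (percolation_space d) R.
Hypotheses (p0 : 0 < p) (p1 : p < 1).
Hypothesis Pp : site_percolation p P.
Hypothesis flux : forall n, 2^-1 <= (3 ^ d)%:R * boundary_flux P n.
Hypothesis d_gt0 : (0 < d)%N.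
Hypothesis alpha_gt : 4 * d%:R ^+ 2 < alpha.

Lemma crossing_decay : exists K g : R, [/\ 0 <= K, 0 < g & forall n, (4 <= n)%N ->
  pr P (crossing_event n (Num.truncn (n%:R + n%:R `^ alpha))) <= K * n%:R `^ (- g)].
Proof.
have p01 : 0 <= p <= 1 by rewrite !ltW.
have d1 : (1 : R) <= d%:R by rewrite ler1n.
have D1 : (1 : R) <= d%:R ^+ 2 by rewrite exprn_ege1.
have a2 : 2 <= alpha by move: alpha_gt D1; lra.
have a0 : 0 < alpha by lra.
pose q : R := (2 * d ^ 2)%:R.
have qE : q = 2 * d%:R ^+ 2 by rewrite /q natrM natrX.
have qa : q / alpha < 2^-1 by rewrite ltr_pdivrMr // qE; move: alpha_gt; lra.
(* [q < alpha * beta] makes the product decay, [beta < 1/2] absorbs the logarithm *)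
pose beta : R := (2^-1 + q / alpha) / 2.
have q0 : 0 <= q / alpha by rewrite divr_ge0 // ltW.
have b0 : 0 < beta by rewrite /beta; lra.
have b2 : 0 < 2^-1 - beta by rewrite /beta; lra.
have g0 : 0 < alpha * beta - q.
  by rewrite subr_gt0 mulrC -ltr_pdivrMr // /beta; lra.
have [K1 [K10 hK1]] := crossing_le_two_arm p0 p1 Pp flux d_gt0.
have [K2 [K20 hK2]] := two_arm_decay p01 Pp d_gt0 p0 p1.
pose K3 : R := K2 * (1 + (2^-1 - beta)^-1) * 4^-1 `^ (- beta).
have K30 : 0 <= K3.
  by rewrite mulr_ge0 ?powR_ge0 // mulr_ge0 // addr_ge0 // invr_ge0 ltW.
exists (K1 * K3), (alpha * beta - q); split=> //; first exact: mulr_ge0.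
move=> n n4; have [M [nMN lM]] := annulus_size a2 n4.
have n0 : (0 < n)%N by apply: leq_trans n4.
have x0 : (0 : R) < n%:R by rewrite ltr0n.
apply: le_trans (hK1 n _ M n0 nMN) _.
set N' : R := (2 * M.+1).+1%:R in lM.
have N1 : 1 <= N' by rewrite ler1n.
have l0 : 0 < n%:R `^ alpha by apply: powR_gt0.
have arm : two_arm_prob P (2 * M.+1) <= K3 * n%:R `^ (- (alpha * beta)).
  apply: le_trans (hK2 M) _; rewrite -/N'.
  apply: le_trans (ler_wpM2l K20 (ln_div_sqrt_le N1 b2)) _.
  rewrite /K3 -!mulrA ler_wpM2l // ler_wpM2l //.
    by rewrite addr_ge0 // invr_ge0 ltW.
  have -> : 2^-1 - beta - 2^-1 = - beta by ring.
  have -> : - (alpha * beta) = alpha * (- beta) by ring.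
  rewrite (powRrM n%:R) mulrC -powRM ?powR_ge0 //.
  have y0 : 0 < n%:R `^ alpha * 4^-1 by rewrite divr_gt0.
  have N0 : 0 < N' by apply: lt_le_trans N1.
  rewrite !powRN lef_pV2 ?posrE ?powR_gt0 //.
  by apply: (ge0_ler_powR (ltW b0)); rewrite ?nnegrE ?(ltW y0) ?(ltW N0).
have -> : K1 * K3 * n%:R `^ (- (alpha * beta - q)) =
    K1 * n%:R ^+ (2 * d ^ 2) * (K3 * n%:R `^ (- (alpha * beta))).
  rewrite -(powR_mulrn _ (ltW x0)) -/q opprB powRD.
    by ring.
  by rewrite (gt_eqF x0) implybT.
by rewrite ler_wpM2l // mulr_ge0 // exprn_ge0 // (ltW x0).
Qed.

End MainEstimate.

Theorem theorem1p2 (R : realType) (d : nat) (hd : (2 <= d)%N)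
  (P : R -> probability (percolation_space d) R)
  (hP : forall p : R, 0 <= p <= 1 -> site_percolation p (P p))
  (alpha : R)
  (halpha : (2 * d%:R ^+ 2 + 2 * d%:R - 2) / (2 * d%:R ^+ 2 + 3 * d%:R - 3)
              * (4 * d%:R ^+ 2 + 5 * d%:R - 5) < alpha) :
  P (critical_probability P) (@two_arms R d n (n%:R `^ alpha)) @[n --> \oo]
    --> 0%E.
Proof.
have pc01 := critical_probability_bounds P.
have Ppc := hP _ pc01.
pose pc := critical_probability P; rewrite -/pc in pc01 Ppc *.
pose N n := Num.truncn (n%:R + n%:R `^ alpha : R).
have supp n := @supported_two_arms R d n _ (powR_ge0 n%:R alpha).
have le_cross n : pr (P pc) (@two_arms R d n (n%:R `^ alpha)) <=
    pr (P pc) (crossing_event n (N n)).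
  have sc := @supported_crossing d n (N n).
  apply: (pr_sub (P pc) (supp n) sc).
  move=> w; apply: two_arms_crossing; exact: powR_ge0.
have [K [g [K0 g0 decay]]] : exists K g : R, [/\ 0 <= K, 0 < g & forall n, (4 <= n)%N ->
    pr (P pc) (crossing_event n (N n)) <= K * n%:R `^ (- g)].
  have [/andP[pc0 pc1]|deg] := boolP (0 < pc < 1).
    apply: (crossing_decay pc0 pc1 Ppc); last exact: exponent_gt halpha.
      by move=> n; apply: (critical_flux hP).
    exact: ltnW.
  exists 0, 1; split=> // n _; rewrite mul0r (pr_crossing_degenerate _ _ Ppc) //.
  have [pc0 pc1] := andP pc01; move: deg; rewrite negb_and -!leNgt => /orP[h|h].
    by left; apply/eqP; rewrite eq_le h.
  by right; apply/eqP; rewrite eq_le h pc1.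
apply/fine_cvgP; split.
  by near=> n; rewrite (prE (P pc) (supp n)).
apply: (@squeeze_cvgr _ _ _ _ (fun=> 0) (fun n => K * n%:R `^ (- g))).
- near=> n; apply/andP; split; first exact: pr_ge0.
  apply: le_trans (le_cross n) _; apply: decay.
  by near: n; exists 4%N.
- exact: cvg_cst.
- exact: powR_cvg_infty.
Unshelve. all: by end_near.
Qed.
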